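(* Let $\alpha,\beta>0$ with $\alpha+\beta<\pi$ be trigonometrically algebraic angles, i.e. $\sin\alpha,\cos\alpha,\sin\beta,\cos\beta$ are algebraic real numbers. Let $p(n)$ denote the complexity of the billiard language of the triangle with interior angles $(\alpha,\beta,\pi-\alpha-\beta)$. Then for every $\varepsilon>0$ there is a constant $C$ such that $p(n)<Ce^{n^{\varepsilon}}$ for all $n\in\mathbb{N}$.
   Context: Billiard in a polygon $Q$: a point mass moves in $Q$ along a straight line until it hits $\partial Q$; on hitting a side it reflects so that the angle of incidence equals the angle of reflection, and continues along the new line; if it hits a vertex, its future motion is not defined. Label the sides of $Q$ by distinct letters of an alphabet $\mathcal{A}$ whose cardinality is the number of sides of $Q$. A billiard orbit hitting $n$ sides successively codes a word of length $n$ in $\mathcal{A}$, given by the sequence of sides it hits. The billiard language is the set of all words obtained from billiard orbits in this way, and its complexity $p(n)$ is the number of words of length $n$ in it. An angle $\theta$ is trigonometrically algebraic if $\sin\theta$ and $\cos\theta$ are algebraic real numbers. (The function $p(n)$ depends only on the triangle up to similarity, so only on its angles.) *)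

(* Defs.v *)
From HB Require Import structures.
From mathcomp Require Import all_boot all_order all_algebra.
From mathcomp Require Import all_classical all_reals all_analysis.

Set Implicit Arguments.
Unset Strict Implicit.
Unset Printing Implicit Defensive.

Import Order.TTheory GRing.Theory Num.Theory.
Import numFieldNormedType.Exports.

Local Open Scope classical_set_scope.
Local Open Scope ring_scope.

Definition trig_algebraic (R : realType) (theta : R) : Prop :=
  algebraicOver ratr (sin theta) /\ algebraicOver ratr (cos theta).

Definition dot (R : realType) (u v : 'rV[R]_2) : R :=
  \sum_(i < 2) u 0 i * v 0 i.

(* The library norm `|u| on 'rV_2 is the sup norm; angles need this one. *)
Definition enorm (R : realType) (u : 'rV[R]_2) : R := Num.sqrt (dot u u).

Definition angle (R : realType) (u v : 'rV[R]_2) : R :=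
  acos (dot u v / (enorm u * enorm v)).

(* The letter i : 'I_3 labels the side from v i to v (i + 1 mod 3). *)
Section Triangle.
Context {R : realType} (v : 'I_3 -> 'rV[R]_2).

Definition noncollinear : bool :=
  free [:: v (ordS 0) - v 0; v (ord_pred 0) - v 0].

Definition triangle : set 'rV[R]_2 :=
  [set x | exists l : 'I_3 -> R,
     [/\ forall i, 0 <= l i, \sum_i l i = 1 & x = \sum_i l i *: v i]].

Definition interior_angle (i : 'I_3) : R :=
  angle (v (ordS i) - v i) (v (ord_pred i) - v i).

Definition side_dir (i : 'I_3) : 'rV[R]_2 := v (ordS i) - v i.

(* Without its endpoints: an orbit that reaches a vertex is not continued. *)
Definition open_side (i : 'I_3) : set 'rV[R]_2 :=
  [set v i + t *: side_dir i | t in `]0, 1[].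

(* Orthogonal reflection in the line spanned by side_dir i: it preserves the
   component of u along the side and negates the normal one. *)
Definition reflect_side (i : 'I_3) (u : 'rV[R]_2) : 'rV[R]_2 :=
  (2 * dot u (side_dir i) / dot (side_dir i) (side_dir i)) *: side_dir i - u.

(* The billiard orbit issued from x with velocity u successively hits the sides
   listed in w: it stays in the topological interior of the triangle until the
   time t of the next hit. *)
Fixpoint orbit_codes (x u : 'rV[R]_2) (w : seq 'I_3) : Prop :=
  if w is i :: w' then
    exists t : R,
      [/\ 0 < t,
          forall s, 0 < s < t -> triangle° (x + s *: u),
          open_side i (x + t *: u) &
          orbit_codes (x + t *: u) (reflect_side i u) w']
  else True.

(* Starting from a boundary point instead gives the same words: move the
   starting point slightly along the orbit, or slightly back before the first
   bounce if that point is itself counted as a hit. *)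
Definition billiard_language : set (seq 'I_3) :=
  [set w | exists x u, [/\ triangle° x, u != 0 & orbit_codes x u w]].

Definition complexity (n : nat) : nat :=
  #|[set w : n.-tuple 'I_3 | `[< billiard_language w >]]%SET|.

End Triangle.

(* Main.v *)
Require Import Defs.
From HB Require Import structures.
From mathcomp Require Import all_boot all_order all_algebra.
From mathcomp Require Import perm mxtens complex.
From mathcomp Require Import all_classical all_reals all_analysis.
From mathcomp Require Import zify ring lra.

(* Unfold the table along an orbit: a word of sides is read by a straight line in
   the plane if and only if an affine functional takes opposite signs at the ends
   of every unfolded side.  These conditions are linear, so if a word can be
   extended in two ways on the left then, by convexity, some line reading it
   issues from a vertex.  Hence it suffices to count the words read by the rays
   issued from a vertex; those of a given length are indexed by disjoint
   intervals of directions.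

   Such a word is determined by its choices at the times where its interval is
   split by an unfolded vertex.  Consider two splits separated by at most g
   letters, and the vector d between the two splitting vertices.  The linear part
   of the unfolding is a product of reflections, whose rotation parts commute:
   up to polynomially many choices, d is determined by the word read between the
   two splits.  As |d| is bounded below, the interval at the first split, of
   length a say, lies within O(n a) of the direction of d (unless a is at least
   of the order of 1/n, when there are few intervals).  For algebraic angles a
   is bounded below by an exponential of -n, so only O(n) dyadic scales of a
   occur, and the first split is determined by d up to polynomially many
   choices.  Applied to the last pair of splits at distance at most g, after
   which there remain O(n / g) choices, this yields
   p(n) <= n^O(1) 3^O(n / g) (p(0) + ... + p(g)).  With g = n / 2 it follows that
   p(n) = n^O(log n). *)

Set Implicit Arguments.
Unset Strict Implicit.
Unset Printing Implicit Defensive.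

Import Order.TTheory GRing.Theory Num.Theory.
Import numFieldNormedType.Exports.

Local Open Scope ring_scope.

(** * The cyclic order on the three letters *)

Notation nx := (@ordS 3).
Notation pv := (@ord_pred 3).

Lemma I3P (i j : 'I_3) : [\/ j = i, j = nx i | j = pv i].
Proof.
have /or3P[] : [|| j == i, j == nx i | j == pv i].
  by case: i j => [[|[|[|//]]] ?] [[|[|[|//]]] ?].
- by move=> /eqP ->; apply: Or31.
- by move=> /eqP ->; apply: Or32.
- by move=> /eqP ->; apply: Or33.
Qed.

Lemma nxE (i : 'I_3) : (nx i == i) = false.
Proof. by case: i => [[|[|[|//]]] ?]. Qed.
Lemma pvE (i : 'I_3) : (pv i == i) = false.
Proof. by case: i => [[|[|[|//]]] ?]. Qed.
Lemma nx_pvE (i : 'I_3) : (nx i == pv i) = false.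
Proof. by case: i => [[|[|[|//]]] ?]. Qed.
Lemma nx_nx (i : 'I_3) : nx (nx i) = pv i.
Proof. by apply: val_inj; case: i => [[|[|[|//]]] ?]. Qed.
Lemma pv_pv (i : 'I_3) : pv (pv i) = nx i.
Proof. by apply: val_inj; case: i => [[|[|[|//]]] ?]. Qed.
Lemma nx_neq_sym (i : 'I_3) : (i == nx i) = false.
Proof. by rewrite eq_sym nxE. Qed.
Lemma pv_neq_sym (i : 'I_3) : (i == pv i) = false.
Proof. by rewrite eq_sym pvE. Qed.
Lemma pv_nxE (i : 'I_3) : (pv i == nx i) = false.
Proof. by rewrite eq_sym nx_pvE. Qed.

Definition I3E := (nxE, pvE, nx_pvE, nx_neq_sym, pv_neq_sym, pv_nxE, @eqxx,
  nx_nx, pv_pv, @ordSK 3, @ord_predK 3).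

Lemma sum_I3 (V : nmodType) (f : 'I_3 -> V) (i : 'I_3) :
  \sum_k f k = f i + f (nx i) + f (pv i).
Proof.
rewrite (bigD1 i) //= (bigD1 (nx i)) ?I3E //= (bigD1 (pv i)) ?I3E //= big1.
  by rewrite addr0 addrA.
by move=> j; case: (I3P i j) => ->; rewrite ?I3E ?andbF.
Qed.

Lemma neqI3 (a b : 'I_3) : a != b -> b = nx a \/ b = pv a.
Proof. by case: (I3P a b) => ->; rewrite ?I3E //; [left|right]. Qed.

(** * Unfolding *)

Section Run.
Variables (R : realFieldType) (q : 'I_3 -> R).
Implicit Types (F G : 'I_3 -> R) (w u : seq 'I_3).

(* F lists the values of an affine functional at the vertices of the current
   triangle.  Crossing side i replaces the vertex pv i by its mirror image, where
   1 - q i and q i are the barycentric coordinates of its orthogonal projection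
   on side i.  Then good F w says that the line where the functional vanishes
   crosses the unfolded sides listed in w. *)
Definition step (i : 'I_3) F : 'I_3 -> R := fun j =>
  if j == pv i then 2 * (1 - q i) * F i + 2 * q i * F (nx i) - F (pv i)
  else F j.

Fixpoint run w F := if w is i :: w' then run w' (step i F) else F.

Fixpoint good F w : Prop :=
  if w is i :: w' then F i * F (nx i) < 0 /\ good (step i F) w' else True.

Definition norep w := sorted (fun a b : 'I_3 => a != b) w.

Lemma step_cur i F : step i F i = F i.
Proof. by rewrite /step I3E. Qed.
Lemma step_nx i F : step i F (nx i) = F (nx i).
Proof. by rewrite /step I3E. Qed.

Lemma eq_step i F G : F =1 G -> step i F =1 step i G.
Proof. by move=> e j; rewrite /step !e. Qed.
Lemma eq_run w F G : F =1 G -> run w F =1 run w G.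
Proof. by elim: w F G => [//|i w IH] F G e /=; apply: IH; apply: eq_step. Qed.
Lemma eq_good F G w : F =1 G -> good F w -> good G w.
Proof.
elim: w F G => [//|i w IH] F G e /= [h1 h2]; rewrite -!e; split=> //.
by apply: IH h2; apply: eq_step.
Qed.

Lemma run_cat w u F : run (w ++ u) F = run u (run w F).
Proof. by elim: w F => //=. Qed.
Lemma run_rcons w a F : run (rcons w a) F = step a (run w F).
Proof. by rewrite -cats1 run_cat. Qed.

Lemma good_cat F w u : good F (w ++ u) <-> good F w /\ good (run w F) u.
Proof.
elim: w F => [|i w IH] F /=; first by split=> // -[].
by rewrite IH; split=> [[? []]|[[]]].
Qed.
Lemma good_rcons F w a :
  good F (rcons w a) <-> good F w /\ run w F a * run w F (nx a) < 0.
Proof. by rewrite -cats1 good_cat /=; split=> -[? []]. Qed.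

Lemma step_lin i a b c F G :
  step i (fun j => a * F j + b * G j + c) =1
  (fun j => a * step i F j + b * step i G j + c).
Proof. by move=> j; rewrite /step; case: ifP => // _; ring. Qed.
Lemma run_lin w a b c F G :
  run w (fun j => a * F j + b * G j + c) =1
  (fun j => a * run w F j + b * run w G j + c).
Proof.
elim: w F G => [//|i w IH] F G j /=.
by rewrite (eq_run _ (step_lin i a b c F G)) IH.
Qed.

Lemma step_opp i F : step i (fun j => - F j) =1 (fun j => - step i F j).
Proof. by move=> j; rewrite /step; case: ifP => // _; ring. Qed.
Lemma good_opp F w : good F w -> good (fun j => - F j) w.
Proof.
elim: w F => [//|i w IH] F /= [h1 /IH h2]; rewrite mulrNN; split=> //.
by apply: eq_good h2 => j; rewrite step_opp.
Qed.

(** Unfolding acts linearly on functionals, so the numbers [run w (fun l => (l == k)%:R) j] are the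
    barycentric coordinates of the unfolded vertex [j] with respect to the initial triangle. *)
Lemma run_bary w F j : run w F j = \sum_k F k * run w (fun l => (l == k)%:R) j.
Proof.
rewrite (sum_I3 _ 0).
have -> : run w F j = run w (fun l => 1 * (F 0 * (l == 0)%:R +
    F (nx 0) * (l == nx 0)%:R + 0) + F (pv 0) * (l == pv 0)%:R + 0) j.
  apply: eq_run => l; case: (I3P 0 l) => ->; rewrite ?I3E /=; ring.
by rewrite run_lin mul1r run_lin !addr0.
Qed.

Lemma run_bary_sum w j : \sum_k run w (fun l => (l == k)%:R) j = 1.
Proof.
have E : run w (fun => 1) j = 1.
  elim: w => [//|i w IH] /=; rewrite -{}[RHS]IH; apply: eq_run => l.
  by rewrite /step; case: ifP => // _; ring.
by rewrite -[RHS]E [RHS]run_bary; apply: eq_bigr => k _; rewrite mul1r.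
Qed.

(** Crossing side [i] moves only the vertex [pv i], so this is the one vertex created by the last
    crossing. *)
Definition apex w := pv (last 0 w).

(** Multiply the relation by [y]: if [mz] were nonpositive as well, [y ^+ 2 * my] would be negative,
    and three weights none of which is positive cannot have sum 1. *)
Lemma opposite_weights (x y z mx my mz : R) : x * y < 0 -> z * y < 0 ->
  mx + my + mz = 1 -> x * mx + y * my + z * mz = 0 -> mx < 0 -> 0 < mz.
Proof.
move=> xy zy s1 s0 mx0; rewrite ltNge; apply/negP => mz0.
have y2 : 0 < y ^+ 2 by rewrite exprn_even_gt0 //=; apply: contraTneq xy => ->; lra.
have : y ^+ 2 * my = - (x * y * mx) - (z * y * mz).
  by rewrite -[RHS]addr0 -(mulr0 y) -s0; ring.
have : 0 < x * y * mx by rewrite nmulr_rgt0.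
have : 0 <= z * y * mz by rewrite mulr_le0 // ltW.
move=> p1 p2 e; have : y ^+ 2 * my < 0 by rewrite e; lra.
by rewrite pmulr_rlt0 //; lra.
Qed.

(* The vertex reached at the end of the word lies strictly beyond the line
   carrying the first side that is crossed. *)
Lemma beyond_first_side F a u : norep (a :: u) -> good F (a :: u) ->
  run (a :: u) F (apex (a :: u)) = 0 ->
  run (a :: u) (fun l => (l == pv a)%:R) (apex (a :: u)) < 0.
Proof.
rewrite /apex /=; elim: u F a => [|b u IH] F a.
  by move=> _ _ _ /=; rewrite /step /= !I3E /= !mulr0; lra.
rewrite [last _ _]/=; move: (last b u) (IH (step a F) b) => l {}IH.
move=> /andP[ab nr] [h1 h2] z0.
have {IH} := IH nr h2 z0.
have := run_bary_sum (b :: u) (pv l).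
move: z0; rewrite -/(run (b :: u) _) -/(run (b :: u) _ _).
rewrite [run _ (step a F) _]run_bary [X in _ -> _ -> _ -> X < 0]run_bary.
case: h2 => h2 _; move: h1 h2.
rewrite -(step_cur a) -(step_nx a); set m := run (b :: u).
rewrite !(sum_I3 _ a) -[run u (step b _) _]/(m _ _).
(* In terms of the triangle entered through [a], the coordinate along the old vertex [pv a] is minus
   the coordinate along its mirror image, so the latter has to be shown positive. *)
set g := step a (fun j => (j == pv a)%:R).
have [-> -> ->] : [/\ g a = 0, g (nx a) = 0 & g (pv a) = -1].
  by rewrite /g /step /= !I3E /=; split=> //; ring.
rewrite !mul0r !add0r mulN1r oppr_lt0.
move=> h1 h2 z0 s1 hb.
case: (neqI3 ab) hb h2 => ->; rewrite !I3E => hb h2.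
- by apply: (opposite_weights (x := step a F a) _ _ s1 z0 hb) => //; rewrite mulrC.
- rewrite mulrC in h1; rewrite [X in X + _ = _]addrC in s1.
  rewrite [X in X + _ = _]addrC in z0.
  by apply: (opposite_weights h1 h2 s1 z0 hb).
Qed.
End Run.

(** * Lines reading a given word: convexity, and rays issued from a vertex *)

Section Cone.
Variables (R : realFieldType) (q : 'I_3 -> R).
Implicit Types (F G : 'I_3 -> R) (w u : seq 'I_3).
Local Notation step := (step q).
Local Notation run := (run q).
Local Notation good := (good q).

Lemma opposite_sgn (x y z t : R) : x * y < 0 -> z * t < 0 -> 0 < x * z -> 0 < y * t.
Proof.
move=> h1 h2 h3; have : 0 < (x * z) * (y * t).
  by rewrite mulrACA nmulr_rgt0.
by rewrite pmulr_rgt0.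
Qed.

Lemma same_sgn_lt0 (s x y : R) : 0 < s * x -> (x * y < 0) = (s * y < 0).
Proof.
move=> sx; have s0 : s != 0 by apply: contraTneq sx => ->; rewrite mul0r ltxx.
have s2 : 0 < s ^+ 2 by rewrite exprn_even_gt0.
rewrite -(pmulr_rlt0 (x * y) s2) (_ : s ^+ 2 * _ = (s * x) * (s * y)); last by ring.
by rewrite pmulr_rlt0.
Qed.

(** Successive sides share a vertex. Agreement of the signs there passes to the other end of the
    side, since both functionals change sign along it. *)
Lemma good_sgn h u F G : norep (h :: u) -> good F (h :: u) -> good G (h :: u) ->
  0 < F h * G h ->
  0 < run (h :: u) F (last h u) * run (h :: u) G (last h u) /\
  0 < run (h :: u) F (nx (last h u)) * run (h :: u) G (nx (last h u)).
Proof.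
elim: u h F G => [|j u IH] h F G.
  move=> _ [h1 _] [h2 _] h3 /=; rewrite !step_cur !step_nx; split=> //.
  exact: opposite_sgn h1 h2 h3.
move=> /andP[hj nr] [f1 f2] [g1 g2] fg.
apply: (IH j (step h F) (step h G) nr f2 g2).
have n0 := opposite_sgn f1 g1 fg.
case: f2 g2 => f2 _ [g2 _]; case: (neqI3 hj) f2 g2 => ->.
  by rewrite !step_nx.
rewrite !I3E !step_cur mulrC => f2; rewrite mulrC => g2.
exact: opposite_sgn f2 g2 fg.
Qed.

Lemma conv_lt0 (a b x y z t : R) : 0 <= a -> 0 <= b -> 0 < a + b ->
  x * y < 0 -> z * t < 0 -> 0 < x * z ->
  (a * x + b * z + 0) * (a * y + b * t + 0) < 0.
Proof.
move=> a0 b0 ab xy zt xz; have yt := opposite_sgn xy zt xz.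
have xt : x * t < 0.
  have : 0 < z ^+ 2.
    by rewrite exprn_even_gt0 //=; apply: contraTneq xz => ->; rewrite mulr0 ltxx.
  move=> z2; rewrite -(pmulr_rlt0 _ z2).
  have -> : z ^+ 2 * (x * t) = (x * z) * (z * t) by ring.
  by rewrite pmulr_rlt0.
have zy : z * y < 0 by rewrite (@same_sgn_lt0 x).
rewrite !addr0 (_ : (a * x + b * z) * _ = a ^+ 2 * (x * y)
  + a * b * (x * t + z * y) + b ^+ 2 * (z * t)); last by ring.
have [a1|a1] := eqVneq a 0.
  have b1 : 0 < b by lra.
  by rewrite a1 expr0n /= !mul0r !add0r pmulr_rlt0 // exprn_gt0.
have {a1}a1 : 0 < a by rewrite lt_def a1.
have h1 : a ^+ 2 * (x * y) < 0 by rewrite pmulr_rlt0 // exprn_gt0.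
have h2 : a * b * (x * t + z * y) <= 0.
  by apply: mulr_ge0_le0; [exact: mulr_ge0 | lra].
have h3 : b ^+ 2 * (z * t) <= 0.
  by apply: mulr_ge0_le0; [exact: sqr_ge0 | exact: ltW].
lra.
Qed.

(** Once the signs agree at [h], they agree at both ends of every crossed side, so each crossing
    condition survives a combination with nonnegative weights. *)
Lemma good_conv a b h u F G : 0 <= a -> 0 <= b -> 0 < a + b ->
  norep (h :: u) -> good F (h :: u) -> good G (h :: u) -> 0 < F h * G h ->
  good (fun j => a * F j + b * G j + 0) (h :: u).
Proof.
move=> a0 b0 ab.
elim: u h F G => [|j u IH] h F G.
  by move=> _ [h1 _] [h2 _] h3; split=> //; apply: conv_lt0.
move=> /andP[hj nr] [f1 f2] [g1 g2] fg; split; first exact: conv_lt0.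
have n0 := opposite_sgn f1 g1 fg.
apply: (eq_good _ (IH j (step h F) (step h G) nr f2 g2 _)).
  by move=> k; rewrite step_lin.
case: f2 g2 => f2 _ [g2 _]; case: (neqI3 hj) f2 g2 => ->.
  by rewrite !step_nx.
rewrite !I3E !step_cur mulrC => f2; rewrite mulrC => g2.
exact: opposite_sgn f2 g2 fg.
Qed.

Lemma no_three_opposite (x y z : R) : x * y < 0 -> y * z < 0 -> 0 <= z * x.
Proof.
move=> xy yz; rewrite leNgt; apply/negP => zx.
have : 0 < (x * y) * (y * z) by rewrite nmulr_rgt0.
have -> : (x * y) * (y * z) = y ^+ 2 * (z * x) by ring.
by apply/negP; rewrite -leNgt mulr_ge0_le0 ?sqr_ge0 ?ltW.
Qed.

(** A line entering a triangle through one side leaves it through only one of the other two, since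
    three numbers cannot have pairwise opposite signs. *)
Lemma good_inj F h u u' : norep (h :: u) -> norep (h :: u') -> size u = size u' ->
  good F (h :: u) -> good F (h :: u') -> u = u'.
Proof.
elim: u u' h F => [|j u IH] [|j' u'] //= h F /andP[hj nr] /andP[hj' nr'] [su].
move=> [f1 f2] [_ f2'].
suff jj : j = j'.
  by rewrite -jj in nr' f2' *; congr (_ :: _); apply: IH su f2 f2'.
case: f2 f2' => f2 _ [f2' _]; move: f1 f2 f2'; rewrite -(step_cur q h) -(step_nx q h).
move: (step h F) => G g1; case: (neqI3 hj) (neqI3 hj') => -> [] -> //; rewrite !I3E => g2 g3.
- by have := no_three_opposite g1 g2; rewrite leNgt g3.
- by have := no_three_opposite g1 g3; rewrite leNgt g2.
Qed.

(* The lines through the vertex pv h that cross side h, parametrised by t in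
   ]0, 1[. *)
Definition ray (h : 'I_3) (t : R) : 'I_3 -> R := fun j =>
  if j == h then t else if j == nx h then t - 1 else 0.

(** Such a word is read by a ray issued from the vertex opposite to its first side. By
    [cone_interval] the admissible [t] form an open interval. *)
Definition cone w := [/\ w != [::], norep w & exists t, good (ray (head 0 w) t) w].

Definition bary w k j := run w (fun l => (l == k)%:R) j.

Lemma run_ray w h t j :
  run w (ray h t) j = t * (bary w h j + bary w (nx h) j) - bary w (nx h) j.
Proof.
rewrite run_bary (sum_I3 _ h) /ray !I3E mul0r addr0 /bary.
by rewrite mulrDr mulrBl mul1r addrA.
Qed.

Lemma norep_rcons w a : norep (rcons w a) -> norep w.
Proof. by case: w => //= b w; rewrite /norep /= rcons_path => /andP[]. Qed.

Lemma norep_last w a : w != [::] -> norep (rcons w a) -> last 0 w != a.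
Proof. by case: w => //= b w _; rewrite /norep /= rcons_path => /andP[]. Qed.

Lemma head_rcons (w : seq 'I_3) a : w != [::] -> head 0 (rcons w a) = head 0 w.
Proof. by case: w. Qed.

Lemma cone_rcons w a : w != [::] -> cone (rcons w a) -> cone w.
Proof.
move=> w0 [_ nr [t]]; rewrite head_rcons // => /good_rcons[gt _].
by split=> //; [exact: norep_rcons nr | exists t].
Qed.

Lemma cone_cat w u : w != [::] -> cone (w ++ u) -> cone w.
Proof.
move=> w0; elim/last_ind: u => [|u a IH]; first by rewrite cats0.
by rewrite -rcons_cat => /cone_rcons/IH; apply; case: w w0 {IH}.
Qed.

Lemma good_ray01 h u t : good (ray h t) (h :: u) -> 0 < t < 1.
Proof. by rewrite /= /ray !I3E => -[]; nra. Qed.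

Lemma ray_conv h a b s t : a + b = 1 ->
  ray h (a * s + b * t) =1 (fun j => a * ray h s j + b * ray h t j + 0).
Proof.
move=> ab j; rewrite /ray; case: ifP => _; first by rewrite addr0.
case: ifP => _; last by rewrite !mulr0 !addr0.
by have -> : b = 1 - a; [lra | ring].
Qed.

Lemma good_ray_conv h u s t r : norep (h :: u) -> good (ray h s) (h :: u) ->
  good (ray h t) (h :: u) -> s <= r <= t -> good (ray h r) (h :: u).
Proof.
move=> nr gs gt /andP[sr rt]; have [st|st] := eqVneq s t.
  by have -> : r = s by apply/eqP; rewrite eq_le sr st rt.
have /andP[s0 _] := good_ray01 gs; have /andP[t0 _] := good_ray01 gt.
have {}st : 0 < t - s by rewrite subr_gt0 lt_neqAle st (le_trans sr).
pose a := (t - r) / (t - s); pose b := (r - s) / (t - s).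
have ab : a + b = 1 by rewrite /a /b; field; lra.
have -> : r = a * s + b * t by rewrite /a /b; field; lra.
apply: (eq_good (fsym (ray_conv h s t ab))).
apply: good_conv => //; rewrite ?ab //.
- by apply: divr_ge0; lra.
- by apply: divr_ge0; lra.
- by rewrite /ray eqxx mulr_gt0.
Qed.

Lemma ray_sgn h u s t : norep (h :: u) -> good (ray h s) (h :: u) ->
  good (ray h t) (h :: u) -> let l := last h u in
  0 < run (h :: u) (ray h s) l * run (h :: u) (ray h t) l /\
  0 < run (h :: u) (ray h s) (nx l) * run (h :: u) (ray h t) (nx l).
Proof.
move=> nr gs gt l; have /andP[s0 _] := good_ray01 gs.
have /andP[t0 _] := good_ray01 gt.
by apply: good_sgn => //; rewrite /ray eqxx mulr_gt0.
Qed.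

Lemma affine_interval (z1 z2 t0 a b : R) : z1 < t0 < z2 -> 0 < a + b * t0 ->
  exists y1 y2, [/\ z1 <= y1, y1 < y2, y2 <= z2 &
    [/\ y1 = z1 \/ b != 0 /\ a + b * y1 = 0, y2 = z2 \/ b != 0 /\ a + b * y2 = 0 &
    forall t, (z1 < t < z2 /\ 0 < a + b * t) <-> y1 < t < y2]].
Proof.
move=> /andP[h1 h2] h0; have [b0|b0|b0] := ltgtP b 0.
- pose y := - a / b; have ay : a + b * y = 0 by rewrite /y; field; lra.
  have yb t : (0 < a + b * t) = (t < y).
    by rewrite -[in LHS](subrK y t) mulrDr addrCA ay addr0 nmulr_rgt0 // subr_lt0.
  have t0y : t0 < y by rewrite -yb.
  have [yz|zy] := leP y z2.
  + exists z1, y; split=> //; first by lra.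
    split; [by left | by right; split=> //; lra | move=> t; rewrite yb].
    by split=> [[/andP[? ?] ?]|/andP[? ?]]; [|split=> //]; apply/andP; split=> //; lra.
  + exists z1, z2; split=> //; first by lra.
    split; [by left | by left | move=> t; rewrite yb].
    by split=> [[]|/andP[? ?]] //; split; [apply/andP; split|]; lra.
- pose y := - a / b; have ay : a + b * y = 0 by rewrite /y; field; lra.
  have yb t : (0 < a + b * t) = (y < t).
    by rewrite -[in LHS](subrK y t) mulrDr addrCA ay addr0 pmulr_rgt0 // subr_gt0.
  have t0y : y < t0 by rewrite -yb.
  have [zy|yz] := leP z1 y.
  + exists y, z2; split=> //; first by lra.
    split; [by right; split=> //; lra | by left | move=> t; rewrite yb].
    by split=> [[/andP[? ?] ?]|/andP[? ?]]; [|split=> //]; apply/andP; split=> //; lra.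
  + exists z1, z2; split=> //; first by lra.
    split; [by left | by left | move=> t; rewrite yb].
    by split=> [[]|/andP[? ?]] //; split; [apply/andP; split|]; lra.
- exists z1, z2; split=> //; first by lra.
  split; [by left | by left | move=> t; split=> [[]//|?]].
  by split=> //; move: h0; rewrite b0 !mul0r.
Qed.

(* The values of the parameter at which the moving ray sweeps over a vertex
   unfolded along a prefix of w. *)
Definition endpoint w (z : R) := exists (k : nat) j, let v := take k w in
  let h := head 0 w in [/\ (k <= size w)%N,
  bary v h j + bary v (nx h) j != 0 &
  z * (bary v h j + bary v (nx h) j) = bary v (nx h) j].

(** Appending a letter prescribes the sign of the functional at the new vertex only. This is one
    affine inequality in [t], whose root is the parameter of the ray through that vertex. *)
Lemma cone_interval w : cone w ->
  exists z1 z2 : R, [/\ 0 <= z1, z1 < z2, z2 <= 1,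
    endpoint w z1 /\ endpoint w z2 &
    forall t, good (ray (head 0 w) t) w <-> z1 < t < z2].
Proof.
elim/last_ind: w => [[]//|w a IH]; case: w IH => [_ _|h u IH].
  (* For a single letter the two ends are the rays through the ends of the first side, swept with
     the empty prefix. *)
  exists 0, 1; split=> //.
    split; [exists 0%N, a | exists 0%N, (nx a)];
      by rewrite /bary /= !I3E /= ?addr0 ?add0r ?mul0r ?mulr1 oner_neq0.
  move=> t; rewrite /= /ray !I3E; split=> [[]|]; nra.
set w := h :: u => cw; have cw' := @cone_rcons w a isT cw.
have [z1 [z2 [z1_ge0 z12 z2_le1 [e1 e2] zP]]] := IH cw'.
case: cw => _ nr [t0]; rewrite head_rcons // => /good_rcons[gt0 sa].
have nrw : norep w := norep_rcons nr.
have la := @norep_last w a isT nr.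
pose l := last h u.
(* The signs at the ends of the last side are the same for all admissible [t], so the next crossing
   is decided by the sign at [pv l]. The factor [s] is the value, for the reference parameter [t0],
   at the end shared with side [a]. *)
have [s sP] : exists s, forall t, good (ray h t) w ->
    (run w (ray h t) a * run w (ray h t) (nx a) < 0) =
    (s * run w (ray h t) (pv l) < 0).
  have : forall t, good (ray h t) w -> _ := fun t gt => ray_sgn nrw gt0 gt.
  rewrite -/w -/l => sgn; case: (neqI3 la) => ->; rewrite [last _ _]/= -/l.
    by exists (run w (ray h t0) (nx l)) => t /sgn[_ ?]; rewrite nx_nx; apply: same_sgn_lt0.
  exists (run w (ray h t0) l) => t /sgn[? _]; rewrite !I3E mulrC.
  exact: same_sgn_lt0.
have zt0 : z1 < t0 < z2 by apply/zP.
pose be := bary w h (pv l) + bary w (nx h) (pv l).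
pose ga := bary w (nx h) (pv l).
have sE t : good (ray h t) w ->
    (run w (ray h t) a * run w (ray h t) (nx a) < 0) = (0 < s * ga + - s * be * t).
  move=> gt; rewrite sP // run_ray -/be -/ga -oppr_gt0; congr (0 < _); ring.
have p0 : 0 < s * ga + - s * be * t0 by rewrite -sE.
have [y1 [y2 [y1_ge y12 y2_le [y1E y2E yP]]]] := affine_interval zt0 p0.
exists y1, y2; split=> //; rewrite ?(le_trans z1_ge0) ?(le_trans _ z2_le1) //.
  have aux y z : endpoint w z -> y = z \/ - s * be != 0 /\ s * ga + - s * be * y = 0 ->
      endpoint (rcons w a) y.
    move=> ez [->|[nz yE]].
      case: ez => k [j [kw ? ?]]; exists k, j; rewrite -cats1 takel_cat //.
      by rewrite size_cat (leq_trans kw) ?leq_addr.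
    exists (size w), (pv l); rewrite -cats1 take_size_cat //=.
    rewrite -[bary w h _ + _]/be -[bary w (nx h) _]/ga size_cat leq_addr.
    move: nz; rewrite mulf_eq0 oppr_eq0 negb_or => /andP[s0 be0]; split=> //.
    apply: (mulfI s0); lra.
  by split; [apply: (aux _ z1) | apply: (aux _ z2)].
move=> t; rewrite good_rcons -yP -zP; split=> -[gt]; last by rewrite sE.
by rewrite sE.
Qed.

Lemma ray_inj w w' t : w != [::] -> norep w -> norep w' -> size w = size w' ->
  head 0 w = head 0 w' ->
  good (ray (head 0 w) t) w -> good (ray (head 0 w') t) w' -> w = w'.
Proof.
case: w w' => [//|h u] [//|h' u'] _ nr nr' /= [su] hh; subst h' => g g'.
by congr (_ :: _); apply: good_inj g g'.
Qed.

Definition split w := [/\ w != [::], cone (rcons w (nx (last 0 w))) &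
  cone (rcons w (pv (last 0 w)))].

Lemma splitW w : split w -> cone w.
Proof. by case=> w0 /cone_rcons cw _; apply: cw. Qed.

(** The rays that continue through the two possible sides leave the last vertex on different sides.
    The value there is affine in the parameter, so an intermediate ray passes through the vertex. *)
Lemma split_zero w : split w -> exists2 t, good (ray (head 0 w) t) w &
  run w (ray (head 0 w) t) (apex w) = 0.
Proof.
case: w => [[]//|h u]; set w := h :: u => -[_ [_ nr [s gs']] [_ _ [t gt']]].
move: gs' gt'; rewrite !head_rcons // => /good_rcons[gs ps] /good_rcons[gt pt].
have nrw : norep w := norep_rcons nr.
have [sg1 sg2] := ray_sgn nrw gs gt; set l := last h u in ps pt sg1 sg2 *.
rewrite -[head 0 w]/h -[last 0 w]/l -[apex w]/(pv l) in gs gt ps pt *.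
move: ps pt; rewrite !I3E => ps pt; rewrite mulrC in pt.
have st : run w (ray h s) (pv l) * run w (ray h t) (pv l) < 0.
  have L F : good F w -> run w F l * run w F (nx l) < 0.
    rewrite /w lastI -/l => /good_rcons[_]; rewrite run_rcons.
    by rewrite step_cur step_nx.
  have gtl := L _ gt; rewrite mulrC in gtl.
  by rewrite (same_sgn_lt0 _ (s := run w (ray h t) l)) // mulrC;
    apply: opposite_sgn ps gtl sg2.
set x := run w (ray h s) (pv l) in st; set y := run w (ray h t) (pv l) in st.
have xy : x - y != 0.
  by rewrite subr_eq0; apply: contraTneq st => ->; rewrite -leNgt -expr2 sqr_ge0.
(* These weights have sum 1, cancel the values [x] and [y], and are nonnegative because [x] and [y]
   have opposite signs. *)
pose a := - y / (x - y); pose b := x / (x - y).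
have ab : a + b = 1 by rewrite /a /b; field.
have r0 : run w (ray h (a * s + b * t)) (pv l) = 0.
  rewrite (eq_run _ _ (ray_conv h s t ab)) run_lin -/x -/y /a /b; field.
  by [].
have a0 : 0 <= a.
  have -> : a = (y ^+ 2 - x * y) / (x - y) ^+ 2 by rewrite /a; field.
  by apply: divr_ge0; [have := sqr_ge0 y; lra | exact: sqr_ge0].
have b0 : 0 <= b.
  have -> : b = (x ^+ 2 - x * y) / (x - y) ^+ 2 by rewrite /b; field.
  by apply: divr_ge0; [have := sqr_ge0 x; lra | exact: sqr_ge0].
exists (a * s + b * t) => //; have [le_st|le_ts] := leP s t.
  apply: good_ray_conv gs gt _ => //; nra.
by apply: good_ray_conv gt gs _ => //; nra.
Qed.

(** The two lines enter the triangle through the two sides other than [h], so they leave the vertex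
    [pv h] on different sides. A convex combination vanishes there and is, up to scaling, a ray
    issued from [pv h]. *)
Lemma left_special h u : norep (h :: u) ->
  (exists F, good F (nx h :: h :: u)) -> (exists F, good F (pv h :: h :: u)) ->
  cone (h :: u).
Proof.
have sgn F : good F (h :: u) -> exists G, [/\ good G (h :: u), 0 < G h,
    0 < F h * F (pv h) -> 0 < G (pv h) & F (pv h) * F h < 0 -> G (pv h) < 0].
  move=> gF; have [Fh|Fh] := ltP 0 (F h).
    by exists F; split=> //; rewrite ?pmulr_rgt0 // pmulr_llt0.
  have {}Fh : F h < 0.
    rewrite lt_neqAle Fh andbT; case: gF => + _.
    by apply: contraTneq => ->; rewrite mul0r ltxx.
  exists (fun j => - F j); rewrite oppr_gt0 nmulr_rgt0 // nmulr_llt0 // oppr_lt0.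
  by rewrite oppr_gt0; split=> //; exact: good_opp.
move=> nr [F1 [s1 g1]] [F2 [s2 g2]].
have [n1 p1] : step (nx h) F1 (nx h) = F1 (nx h) /\ step (nx h) F1 (pv h) = F1 (pv h).
  by rewrite step_cur -(nx_nx h) step_nx.
have [n2 p2] : step (pv h) F2 h = F2 h /\ step (pv h) F2 (pv h) = F2 (pv h).
  by have := step_nx q (pv h) F2; rewrite (@ord_predK 3) step_cur.
rewrite nx_nx -n1 -p1 in s1; rewrite (@ord_predK 3) -n2 -p2 in s2.
have nz : 0 < step (nx h) F1 (nx h) * step (nx h) F1 (nx h).
  rewrite -expr2 exprn_even_gt0 //=.
  by apply: contraTneq s1 => ->; rewrite mul0r ltxx.
have s1' := g1.1; rewrite mulrC in s1'; have {nz}s1 := opposite_sgn s1' s1 nz.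
have [H1 [gH1 H1h H1p _]] := sgn _ g1.
have [H2 [gH2 H2h _ /(_ s2) H2p]] := sgn _ g2.
have {}H1p := H1p s1.
have H1n : H1 (nx h) < 0 by have := gH1.1; rewrite pmulr_rlt0.
have H2n : H2 (nx h) < 0 by have := gH2.1; rewrite pmulr_rlt0.
(* The weights make the combination vanish at [pv h]; dividing by [D] makes its values at [h] and
   [nx h] differ by 1, as for [ray]. *)
pose a := - H2 (pv h); pose b := H1 (pv h).
pose D := a * (H1 h - H1 (nx h)) + b * (H2 h - H2 (nx h)).
have D0 : 0 < D by apply: addr_gt0; apply: mulr_gt0; rewrite /a /b; lra.
split=> //; exists ((a * H1 h + b * H2 h) / D).
have : good (fun j => a / D * H1 j + b / D * H2 j + 0) (h :: u).
  apply: good_conv => //; last exact: mulr_gt0.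
  - by apply: divr_ge0; rewrite /a; lra.
  - by apply: divr_ge0; rewrite /b; lra.
  - by rewrite -mulrDl divr_gt0 // /a /b; lra.
apply: eq_good => j; rewrite /ray /=.
have D1 : D != 0 by rewrite gt_eqF.
case: (I3P h j) => ->; rewrite !I3E; apply: (mulIf D1).
- by field.
- by rewrite [RHS]mulrBl mul1r divfK // [in RHS]/D; field.
- by rewrite mul0r /a /b; field.
Qed.

End Cone.

(** * Algebraic numbers of bounded height *)

Section CommonEigenvector.
Variable R : realFieldType.

Local Notation "M ^R" := (map_mx (@ratr R) M) (at level 2, format "M ^R").

(** The powers of [x] form an eigenvector of the companion matrix of a monic rational polynomial
    vanishing at [x]. *)
Lemma integral_eigen (x : R) : algebraicOver ratr x ->
  exists (d : nat) (e : 'cV[R]_d) (M : 'M[rat]_d), e != 0 /\ M^R *m e = x *: e.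
Proof.
move=> /integral_algebraic[p pmon px].
pose d := (size p).-1; exists d.
have d0 : (0 < d)%N.
  rewrite /d -subn1 subn_gt0 ltnNge; apply/negP => sp.
  have [c pc] : exists c, p = c%:P by exists p`_0; apply: size1_polyC.
  move: pmon px; rewrite pc monicE lead_coefC map_polyC rootC fmorph_eq0.
  by move=> /eqP ->; rewrite oner_eq0.
pose e : 'cV[R]_d := \col_i x ^+ i.
pose M : 'M[rat]_d := \matrix_(i, j) if i.+1 == d then - p`_j else (j == i.+1 :> nat)%:R.
exists e, M; split.
  by apply/eqP => /colP/(_ (Ordinal d0)); rewrite !mxE => /eqP; rewrite oner_eq0.
apply/colP => i; rewrite !mxE; have [id|id] := eqVneq i.+1 d; last first.
  have lt : (i.+1 < d)%N by rewrite ltn_neqAle id ltn_ord.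
  rewrite (bigD1 (Ordinal lt)) //= big1 ?addr0.
    by rewrite !mxE (negPf id) eqxx rmorph1 mul1r exprS.
  move=> j; rewrite -val_eqE /= !mxE (negPf id) => /negPf ->.
  by rewrite rmorph0 mul0r.
rewrite -exprS id; move: px; rewrite /root horner_coef size_map_poly.
have sp : size p = d.+1 by rewrite /d prednK // size_poly_gt0 monic_neq0.
rewrite sp big_ord_recr /= coef_map /= (_ : p`_d = 1); last first.
  by have := monicP pmon; rewrite lead_coefE sp.
rewrite rmorph1 mul1r addrC addr_eq0 => /eqP ->.
rewrite -sumrN; apply: eq_bigr => j _; rewrite !mxE id eqxx coef_map /=.
by rewrite rmorphN mulNr.
Qed.

(** The tensor product of the eigenvectors of the single numbers is an eigenvector for all of them:
    each matrix acts on its own factor. *)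
Lemma common_eigen (xs : seq R) : {in xs, forall x, algebraicOver ratr x} ->
  exists (d : nat) (e : 'cV[R]_d), e != 0 /\
    {in xs, forall x, exists M : 'M[rat]_d, M^R *m e = x *: e}.
Proof.
elim: xs => [_|x xs IH xsP].
  exists 1%N, 1%:M; split=> //; apply/eqP => /matrixP/(_ 0 0).
  by rewrite !mxE => /eqP; rewrite oner_eq0.
have [d [e [e0 eP]]] : exists (d : nat) (e : 'cV[R]_d), e != 0 /\
    {in xs, forall x, exists M : 'M[rat]_d, M^R *m e = x *: e}.
  by apply: IH => y yxs; apply: xsP; rewrite inE yxs orbT.
have [m [f [N [f0 fP]]]] := integral_eigen (xsP x (mem_head _ _)).
exists (d * m)%N, (e *t f : 'cV_(d * m)); split.
  have [i ei] : exists i, e i 0 != 0.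
    apply/existsP; apply: contraNT e0 => /existsPn e0; apply/eqP/colP => i.
    by rewrite mxE; apply/eqP; have := e0 i; rewrite negbK.
  have [j fj] : exists i, f i 0 != 0.
    apply/existsP; apply: contraNT f0 => /existsPn f0; apply/eqP/colP => j.
    by rewrite mxE; apply/eqP; have := f0 j; rewrite negbK.
  apply/eqP => /matrixP/(_ (mxtens_index (i, j)) 0).
  by rewrite !mxE mxtens_indexK /= !ord1 => /eqP; rewrite mulf_eq0 (negPf ei) (negPf fj).
move=> y; rewrite inE => /orP[/eqP ->|/eP[M MP]].
  exists (1%:M *t N); rewrite map_mxT map_mx1.
  apply: etrans (tensmx_mul 1%:M N^R e f) _; rewrite mul1mx fP.
  by apply/matrixP => a b; rewrite !mxE; ring.
exists (M *t 1%:M); rewrite map_mxT map_mx1.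
apply: etrans (tensmx_mul M^R 1%:M e f) _; rewrite mul1mx MP.
by apply/matrixP => a b; rewrite !mxE; ring.
Qed.

(** A rational relation between the coordinates of [e] allows [e] to be replaced by a shorter vector
    with the same eigenvalues; iterate until no relation is left. *)
Lemma independent_eigen (xs : seq R) (d : nat) (e : 'cV[R]_d) : e != 0 ->
  {in xs, forall x, exists M : 'M[rat]_d, M^R *m e = x *: e} ->
  exists (d : nat) (e : 'cV[R]_d), [/\ e != 0,
    forall c : 'rV[rat]_d, c^R *m e = 0 -> c = 0 &
    {in xs, forall x, exists M : 'M[rat]_d, M^R *m e = x *: e}].
Proof.
have [n] := ubnP d; elim: n d e => // n IH d e dn e0 eP.
have [H|] := pselect (forall c : 'rV[rat]_d, c^R *m e = 0 -> c = 0).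
  by exists d, e.
move=> /existsNP[c /not_implyP[ce /eqP c0]].
(* As [w] is a right inverse of [c], the matrix [N] is a rational projection of rank less than [d]
   that fixes [e]. Its rank factorisation gives the shorter vector. *)
pose w := pinvmx c; pose N := 1%:M - w *m c.
have cw : c *m w = 1%:M.
  by apply: mulmxVp; rewrite /row_free rank_rV c0.
have Ne : N^R *m e = e.
  by rewrite /N map_mxB map_mx1 map_mxM mulmxBl mul1mx -mulmxA ce mulmx0 subr0.
have cN : c *m N = 0 by rewrite /N mulmxBr mulmx1 mulmxA cw mul1mx subrr.
have rN : (\rank N < d)%N.
  rewrite ltn_neqAle rank_leq_row andbT; apply/negP => rN.
  by move: c0; rewrite -(mulmx_free_eq0 _ (rN : row_free N)) cN eqxx.
pose e' := (row_base N)^R *m e.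
have Se' : (col_base N)^R *m e' = e by rewrite mulmxA -map_mxM mulmx_base.
apply: (IH _ e').
- by rewrite -ltnS; apply: leq_trans dn.
- by apply: contraNneq e0 => e'0; rewrite -Se' e'0 mulmx0.
move=> x /eP[M MP]; exists (row_base N *m M *m col_base N).
by rewrite (map_mxM _ (_ *m M)) (map_mxM _ _ M) -mulmxA Se' -mulmxA MP /e' -scalemxAr.
Qed.

End CommonEigenvector.

Lemma norm_det_le (n : nat) (A : 'M[int]_n) (b : int) :
  (forall i j, `|A i j| <= b) -> `|\det A| <= n`!%:R * b ^+ n.
Proof.
move=> Ab; rewrite /determinant (le_trans (ler_norm_sum _ _ _)) //.
have -> : n`!%:R * b ^+ n = \sum_(s : 'S_n) b ^+ n.
  by rewrite sumr_const card_Sn mulr_natl.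
apply: ler_sum => s _; rewrite normrM normrX normrN1 expr1n mul1r normr_prod.
rewrite -[n in b ^+ n]card_ord -prodr_const.
by apply: ler_prod => i _; rewrite normr_ge0 Ab.
Qed.

Lemma norm_adj_le (n : nat) (A : 'M[int]_n) (b : int) : 1 <= b ->
  (forall i j, `|A i j| <= b) -> forall i j, `|(\adj A) i j| <= n`!%:R * b ^+ n.
Proof.
move=> b1 Ab i j; rewrite !mxE /cofactor normrM normrX normrN1 expr1n mul1r.
apply: le_trans (norm_det_le (b := b) _) _ => [k l|]; first by rewrite !mxE Ab.
have n0 : (0 < n)%N by apply: leq_ltn_trans (ltn_ord i).
rewrite ler_pM // ?ler0n ?exprn_ge0 ?(le_trans _ b1) //.
  by rewrite ler_nat leq_fact // leq_pred.
by rewrite ler_weXn2l // leq_pred.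
Qed.

Lemma common_denominator (n : nat) (M : 'M[rat]_n) :
  exists Q : nat, (0 < Q)%N /\ exists Z : 'M[int]_n, Q%:R *: M = map_mx intr Z.
Proof.
pose Q := (\prod_(p : 'I_n * 'I_n) `|denq (M p.1 p.2)|)%N.
exists Q; split; first by rewrite prodn_gt0 // => p; rewrite absz_gt0 denq_neq0.
exists (\matrix_(i, j) numq (Q%:R * M i j)); apply/matrixP => i j; rewrite !mxE.
have -> : Q%:R * M i j = (numq (M i j) *
    \prod_(p : 'I_n * 'I_n | p != (i, j)) `|denq (M p.1 p.2)|)%:~R.
  rewrite /Q (bigD1 (i, j)) //= natrM natr_absz ger0_norm ?denq_ge0 //.
  rewrite intrM numqE mulrC mulrA; congr (_ * _).
  by rewrite natr_prod rmorph_prod; apply: eq_bigr => p _; rewrite natr_absz.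
by rewrite numq_int.
Qed.

Section BoundedHeight.
Variable R : realFieldType.
Variables (d : nat) (e : 'cV[R]_d).
Hypothesis e0 : e != 0.
Hypothesis e_free : forall c : 'rV[rat]_d, map_mx ratr c *m e = 0 -> c = 0.
Variables (Q B : nat).
Hypotheses (Q0 : (0 < Q)%N) (QB : (2 * Q * d <= B)%N).

(* Multiplication by y acts on e through a rational matrix with denominator
   Q ^ D and numerators bounded by B ^ D.  When the coordinates of e are linearly
   independent over the rationals, the determinant of this matrix bounds y away
   from 0. *)
Definition height (D : nat) (y : R) := exists Z : 'M[int]_d,
  map_mx intr Z *m e = (Q%:R ^+ D * y) *: e /\ (forall i j, `|Z i j| <= B%:R ^+ D).

Let d0 : (0 < d)%N.
Proof. by case: d e e0 => // f; rewrite flatmx0 eqxx. Qed.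

Let QleB : (Q <= B)%N.
Proof. by apply: leq_trans QB; rewrite mulnAC leq_pmull ?muln_gt0. Qed.

Let B0 : 1 <= B%:R :> int.
Proof. by rewrite ler1n (leq_trans Q0). Qed.

Lemma height0 D : height D 0.
Proof.
exists 0; split=> [|i j]; first by rewrite mulr0 scale0r map_mx0 mul0mx.
by rewrite mxE normr0 exprn_ge0 // (le_trans _ B0).
Qed.

Lemma height1 : height 0 1.
Proof.
exists 1%:M; split=> [|i j]; first by rewrite map_mx1 mul1mx expr0 mul1r scale1r.
by rewrite mxE; case: (i == j).
Qed.

Lemma heightN D x : height D x -> height D (- x).
Proof.
move=> [Z [eZ bZ]]; exists (- Z); split=> [|i j]; last by rewrite mxE normrN.
by rewrite map_mxN mulNmx eZ mulrN scaleNr.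
Qed.

Lemma heightS D x : height D x -> height D.+1 x.
Proof.
move=> [Z [eZ bZ]]; exists (Q%:R *: Z); split=> [|i j].
  by rewrite map_mxZ rmorph_nat -scalemxAl eZ scalerA mulrA exprS.
by rewrite mxE normrM exprS ler_pM // ger0_norm // ?ler_nat // ler0n.
Qed.

(** The extra unit of height supplies one more factor [Q] on the denominator side, while
    [2 * Q <= B] absorbs the doubling of the entries. For products, [Q * d <= B] absorbs the sum
    over [d] terms. *)
Lemma heightD D x y : height D x -> height D y -> height D.+1 (x + y).
Proof.
move=> [Z [eZ bZ]] [Y [eY bY]]; exists (Q%:R *: (Z + Y)); split=> [|i j].
  rewrite map_mxZ map_mxD rmorph_nat -scalemxAl mulmxDl eZ eY -scalerDl scalerA.
  by rewrite -mulrDr mulrA exprS.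
rewrite !mxE normrM exprS ger0_norm ?ler0n //.
have: Q%:R * `|Z i j + Y i j| <= Q%:R * (2 * B%:R ^+ D).
  rewrite ler_pM2l ?ltr0n // (le_trans (ler_normD _ _)) //.
  by have := bZ i j; have := bY i j; lra.
move=> /le_trans; apply; rewrite mulrA ler_pM2r ?exprn_gt0 ?(lt_le_trans _ B0) //.
rewrite -natrM ler_nat mulnC (leq_trans _ QB) // leq_pmulr //.
Qed.

Lemma heightM D D' x y : height D x -> height D' y -> height (D + D').+1 (x * y).
Proof.
move=> [Z [eZ bZ]] [Y [eY bY]]; exists (Q%:R *: (Z *m Y)); split=> [|i j].
  rewrite map_mxZ map_mxM rmorph_nat -scalemxAl -mulmxA eY -scalemxAr eZ !scalerA.
  by congr (_ *: _); rewrite exprS exprD; ring.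
rewrite !mxE normrM exprS ger0_norm ?ler0n //.
have: Q%:R * `|\sum_k Z i k * Y k j| <= Q%:R * (d%:R * B%:R ^+ (D + D')).
  rewrite ler_pM2l ?ltr0n // (le_trans (ler_norm_sum _ _ _)) //.
  rewrite -[d in d%:R]card_ord mulr_natl -sumr_const ler_sum // => k _.
  by rewrite normrM exprD ler_pM.
move=> /le_trans; apply; rewrite mulrA ler_pM2r ?exprn_gt0 ?(lt_le_trans _ B0) //.
rewrite -natrM ler_nat (leq_trans _ QB) // -mulnA leq_pmull //.
Qed.

Let K := (Q * d * d`! * B ^ d)%N.

Let max_coord : exists k, 0 < `|e k 0| /\ forall j, `|e j 0| <= `|e k 0|.
Proof.
pose k := [arg max_(k > Ordinal d0) `|e k 0|]%O.
have kP j : `|e j 0| <= `|e k 0|.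
  by rewrite /k; case: arg_maxP => // i _; apply.
exists k; split=> //; rewrite lt_neqAle normr_ge0 andbT eq_sym.
apply: contraNneq e0 => k0; apply/eqP/colP => j; rewrite mxE.
by apply/eqP; rewrite -normr_le0 -k0 kP.
Qed.

(** Compare both sides of the eigenvector equation at a coordinate of [e] of largest absolute
    value. *)
Lemma height_le D y : height D y -> `|y| <= K%:R ^+ D.+1.
Proof.
move=> [Z [eZ bZ]]; have [k [ek kP]] := max_coord.
have /matrixP/(_ k 0)/(congr1 Num.norm) := eZ; rewrite !mxE => E.
have: `|Q%:R ^+ D * y * e k 0| <= d%:R * B%:R ^+ D * `|e k 0|.
  rewrite -E (le_trans (ler_norm_sum _ _ _)) //.
  rewrite -mulrA -[d in d%:R]card_ord mulr_natl -sumr_const ler_sum // => j _.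
  rewrite !mxE normrM ler_pM // -intr_norm.
  by rewrite -[B%:R](rmorph_nat (intmul 1)) -rmorphXn ler_int.
rewrite normrM ler_pM2r // normrM normrX normr_nat => h.
have : `|y| <= d%:R * B%:R ^+ D.
  apply: le_trans h; rewrite ler_peMl // exprn_ege1 // ler1n //.
move=> /le_trans; apply; rewrite -!natrX -natrM ler_nat expnS.
have dK : (d <= K)%N.
  by rewrite /K -!mulnA mulnCA leq_pmulr // !muln_gt0 Q0 fact_gt0 expn_gt0 (leq_trans Q0).
have BK : (B <= K)%N.
  rewrite /K; apply: (@leq_trans (B ^ d)).
    by rewrite -{1}(expn1 B) leq_pexp2l // (leq_trans Q0).
  by rewrite leq_pmull // !muln_gt0 Q0 fact_gt0 d0.
by rewrite leq_mul //; case: (D) => // m; rewrite leq_exp2r.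
Qed.

(** A row vector killed by [Z] would be a rational relation between the coordinates of [e], so
    [\det Z] is a nonzero integer. Multiplying the eigenvector equation by the adjugate then bounds
    [y] below, at a coordinate of [e] of largest absolute value. *)
Lemma height_ge D y : height D y -> y != 0 -> K%:R ^- D.+1 <= `|y|.
Proof.
move=> [Z [eZ bZ]] y0; have [k [ek kP]] := max_coord.
have detZ : \det Z != 0.
  apply/negP => /det0P[v v0 vZ].
  have : map_mx intr v = 0 :> 'rV[rat]_d.
    apply: e_free; have : (Q%:R ^+ D * y) *: (map_mx ratr (map_mx intr v) *m e) = 0.
      have -> : map_mx ratr (map_mx intr v) = map_mx intr v :> 'rV[R]_d.
        by apply/rowP => j; rewrite !mxE ratr_int.
      by rewrite scalemxAr -eZ mulmxA -map_mxM vZ map_mx0 mul0mx.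
    have Qy : Q%:R ^+ D * y != 0.
      by rewrite mulf_neq0 // expf_neq0 // pnatr_eq0 -lt0n.
    by move/eqP; rewrite scaler_eq0 (negPf Qy) => /eqP.
  move=> /matrixP v0'; case/eqP: v0; apply/rowP => j; have := v0' 0 j.
  by rewrite !mxE => /eqP; rewrite intr_eq0 => /eqP.
have det1 : 1 <= `|(\det Z)%:~R : R|.
  by rewrite -intr_norm ler1z -gtz0_ge1 normr_gt0.
pose A : int := d`!%:R * (B%:R ^+ D) ^+ d.
have adjA := norm_adj_le (exprn_ege1 _ B0) bZ.
have E : (\det Z)%:~R *: e = (Q%:R ^+ D * y) *: (map_mx intr (\adj Z) *m e).
  rewrite scalemxAr -eZ mulmxA -map_mxM mul_adj_mx.
  by rewrite map_scalar_mx mul_scalar_mx.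
have /matrixP/(_ k 0)/(congr1 Num.norm) := E; rewrite !mxE => {}E.
have: `|e k 0| <= Q%:R ^+ D * `|y| * (d%:R * A%:~R) * `|e k 0|.
  apply: (@le_trans _ _ `|(\det Z)%:~R * e k 0|).
    by rewrite normrM ler_peMl.
  rewrite E 2!normrM normrX normr_nat -!mulrA !ler_wpM2l ?exprn_ge0 //.
  rewrite (le_trans (ler_norm_sum _ _ _)) // mulrA -mulrA.
  rewrite -[d in d%:R]card_ord mulr_natl -sumr_const ler_sum // => j _.
  by rewrite mxE normrM ler_pM // -intr_norm ler_int.
rewrite -[leLHS]mul1r ler_pM2r // => h.
have K0 : (0 < K)%N.
  by rewrite /K !muln_gt0 Q0 d0 fact_gt0 expn_gt0 (leq_trans Q0).
have AK : Q%:R ^+ D * (d%:R * A%:~R) <= K%:R ^+ D.+1 :> R.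
  rewrite /A intrM !rmorphXn /= !rmorph_nat -!natrX -!natrM ler_nat.
  rewrite /K !expnMn -!mulnA !leq_mul //.
  - by rewrite leq_pexp2l.
  - by rewrite -{1}(expn1 d) leq_pexp2l.
  - by rewrite -{1}(expn1 d`!) leq_pexp2l ?fact_gt0.
  - by rewrite -!expnM leq_pexp2l ?(leq_trans Q0) // mulnC leq_mul2l leqnSn orbT.
rewrite -[leLHS]mul1r ler_pdivrMr ?exprn_gt0 ?ltr0n //.
apply: (le_trans h); rewrite mulrAC mulrC ler_wpM2l //.
Qed.
End BoundedHeight.

Lemma integer_multiplier (R : realFieldType) (xs : seq R) (d : nat) (e : 'cV[R]_d) :
  {in xs, forall x, exists M : 'M[rat]_d, map_mx ratr M *m e = x *: e} ->
  exists Q : nat, (0 < Q)%N /\ {in xs, forall x, exists Z : 'M[int]_d,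
    map_mx intr Z *m e = (Q%:R * x) *: e}.
Proof.
elim: xs => [_|x xs IH xsP]; first by exists 1%N.
have [Q [Q0 QP]] : exists Q : nat, (0 < Q)%N /\ {in xs, forall x,
    exists Z : 'M[int]_d, map_mx intr Z *m e = (Q%:R * x) *: e}.
  by apply: IH => y yxs; apply: xsP; rewrite inE yxs orbT.
have [M Mx] := xsP x (mem_head _ _); have [Q' [Q'0 [Z ZP]]] := common_denominator M.
exists (Q' * Q)%N; split=> [|y]; first by rewrite muln_gt0 Q'0.
rewrite inE => /orP[/eqP ->|/QP[Y YP]].
  exists (Q%:R *: Z); rewrite map_mxZ rmorph_nat natrM.
  have -> : map_mx intr Z = map_mx ratr (map_mx intr Z : 'M[rat]_d) :> 'M[R]_d.
    by apply/matrixP => i j; rewrite !mxE ratr_int.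
  rewrite -ZP map_mxZ rmorph_nat -!scalemxAl Mx !scalerA; congr (_ *: _); ring.
exists (Q'%:R *: Y); rewrite map_mxZ rmorph_nat natrM -scalemxAl YP scalerA.
by rewrite mulrA.
Qed.

Lemma integer_multiplier_le (R : realFieldType) (xs : seq R) (d : nat)
    (e : 'cV[R]_d) (Q : nat) :
  {in xs, forall x, exists Z : 'M[int]_d, map_mx intr Z *m e = (Q%:R * x) *: e} ->
  exists B0 : nat, forall B, (B0 <= B)%N -> {in xs, forall x, height e Q B 1 x}.
Proof.
elim: xs => [_|x xs IH xsP]; first by exists 0%N.
have [B0 B0P] : exists B0 : nat, forall B, (B0 <= B)%N ->
    {in xs, forall x, height e Q B 1 x}.
  by apply: IH => y yxs; apply: xsP; rewrite inE yxs orbT.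
have [Z ZP] := xsP x (mem_head _ _).
exists (B0 + \sum_i \sum_j `|Z i j|)%N => B leB y.
rewrite inE => /orP[/eqP ->|yxs]; last first.
  by apply: B0P => //; apply: leq_trans leB; apply: leq_addr.
exists Z; split=> // i j; rewrite expr1 -abszE (_ : B%:R = B%:Z) ?natz // lez_nat.
apply: leq_trans leB; apply: leq_trans (leq_addl _ _).
by rewrite (bigD1 i) //= (bigD1 j) //= -addnA leq_addr.
Qed.

(** All elements of [xs] act on one common vector, so one notion of height covers every polynomial
    expression in them. Only its growth under the operations and the resulting two-sided bound are
    used afterwards. *)
Lemma height_theory (R : realFieldType) (xs : seq R) :
  {in xs, forall x, algebraicOver ratr x} ->
  exists (K : nat) (ht : nat -> R -> Prop), (0 < K)%N /\
  [/\ ht 0 0 /\ ht 0 1,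
    forall D x, ht D x -> ht D (- x) /\ ht D.+1 x,
    forall D x y, ht D x -> ht D y -> ht D.+1 (x + y),
    forall D D' x y, ht D x -> ht D' y -> ht (D + D').+1 (x * y) &
    {in xs, forall x, ht 1 x} /\
    forall D x, ht D x -> `|x| <= K%:R ^+ D.+1 /\
      (x != 0 -> K%:R ^- D.+1 <= `|x|)].
Proof.
move=> /common_eigen[d' [e' [e'0 /(independent_eigen e'0)]]].
move=> [d [e [e0 ei eP]]].
have [Q [Q0 [B [QB QP]]]] : exists Q, (0 < Q)%N /\ exists B, (2 * Q * d <= B)%N /\
    {in xs, forall x, height e Q B 1 x}.
  have [Q [Q0 QP]] := integer_multiplier eP; exists Q; split=> //.
  have [B BP] := integer_multiplier_le QP; exists (B + 2 * Q * d)%N.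
  by split; [apply: leq_addl | apply/BP/leq_addr].
have d0 : (0 < d)%N by case: d e e0 {ei eP QB QP} => // f; rewrite flatmx0 eqxx.
exists (Q * d * d`! * B ^ d)%N, (height e Q B); split.
  rewrite !muln_gt0 Q0 d0 fact_gt0 expn_gt0 (leq_trans _ QB) //.
  by rewrite !muln_gt0 Q0.
split.
- by split; [apply: height0 | apply: height1].
- by move=> D x hx; split; [apply: heightN | apply: heightS].
- by move=> D x y; apply: heightD.
- by move=> D D' x y; apply: heightM.
- split=> // D x hx; split; [exact: height_le hx | move=> ?; exact: height_ge hx _].
Qed.

(** An endpoint is a quotient built from barycentric coordinates, whose height is linear in the
    length because each crossing adds a bounded amount. Hence distinct endpoints differ by at least
    an exponentially small quantity. *)
Lemma endpoint_gap (R : realFieldType) (q : 'I_3 -> R) :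
  (forall i, algebraicOver ratr (q i)) ->
  exists K : nat, (0 < K)%N /\ forall w z1 z2, endpoint q w z1 ->
    endpoint q w z2 -> z1 < z2 -> K%:R ^- (size w).+1 <= z2 - z1.
Proof.
move=> qalg.
pose xs := [seq 2 * (1 - q i) | i : 'I_3] ++ [seq 2 * q i | i : 'I_3].
have alg2 : algebraicOver (@ratr R) 2 by rewrite -(rmorph_nat ratr); apply: algebraic_id.
have : {in xs, forall x, algebraicOver ratr x}.
  move=> x; rewrite mem_cat => /orP[] /mapP[i _ ->]; apply: algebraic_mul => //.
  by apply: algebraic_sub => //; apply: algebraic1.
move=> /height_theory[K [ht [K0 [[ht0 ht1] htNS htD htM [htx htb]]]]].
have htW D D' x : (D <= D')%N -> ht D x -> ht D' x.
  move=> /subnKC <- hx; elim: (D' - D)%N => [|k IH]; first by rewrite addn0.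
  by rewrite addnS; case: (htNS _ _ IH).
(* Multiplying by a coefficient of height 1 raises the height by 2, and each of the two sums by 1,
   whence 4 in all. *)
have ht_step D F i : (forall j, ht D (F j)) -> forall j, ht (D + 4)%N (step q i F j).
  move=> hF j; rewrite /step; case: ifP => _; last by apply: htW (hF j); lia.
  have m x k : x \in xs -> ht D.+2 (x * F k).
    by move=> /htx hx; apply: (htM 1%N D).
  rewrite addn4; apply: (htD); last first.
    by case: (htNS D (F (pv i)) (hF _)) => h _; apply: htW h; lia.
  apply: (htD); apply: (m); rewrite mem_cat; apply/orP; [left|right];
    by apply/mapP; exists i; rewrite ?mem_enum.
have ht_run w F D : (forall j, ht D (F j)) -> forall j, ht (D + 4 * size w)%N (run q w F j).
  elim: w F D => [|i w IH] F D hF j /=; first by rewrite muln0 addn0.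
  by rewrite mulnS addnA; apply: (IH); apply: (ht_step).
have ht_bary w n k j : (size w <= n)%N -> ht (4 * n)%N (bary q w k j).
  move=> wn; apply: (htW (4 * size w)%N); first by rewrite leq_mul.
  by apply: (ht_run w _ 0%N) => l; case: (l == k).
(* The numerator of the difference has height [8 * n + 3] and each denominator [4 * n + 1], so the
   total exponent is [16 * n + 8], below [16 * n.+1]. *)
exists (K ^ 16)%N; split=> [|w z1 z2]; first by rewrite expn_gt0 K0.
set n := size w.
have aux z : endpoint q w z ->
    exists b s, [/\ ht (4 * n)%N b, ht (4 * n).+1 s, s != 0 & z = b / s].
  move=> [k [j [kw s0 zE]]]; exists (bary q (take k w) (nx (head 0 w)) j).
  exists (bary q (take k w) (head 0 w) j + bary q (take k w) (nx (head 0 w)) j).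
  have kn : (size (take k w) <= n)%N by rewrite size_take; case: ifP => // /ltnW.
  split=> //; first exact: ht_bary.
    by apply: (htD); apply: (ht_bary).
  exact: canRL (mulfK s0) zE.
move=> /aux[b1 [s1 [hb1 hs1 s10 ->]]] /aux[b2 [s2 [hb2 hs2 s20 ->]]] lt.
have E : b2 / s2 - b1 / s1 = (b2 * s1 - b1 * s2) / (s1 * s2) by field; apply/andP.
have hN : ht (8 * n + 3)%N (b2 * s1 - b1 * s2).
  have e : (8 * n + 3)%N = (4 * n + (4 * n).+1).+1.+1 by lia.
  by rewrite e; apply: (htD); [apply: (htM)|case: (htNS _ _ (htM _ _ _ _ hb1 hs2))].
have N0 : b2 * s1 - b1 * s2 != 0.
  by apply: contraTneq lt => N0; rewrite -subr_gt0 E N0 mul0r ltxx.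
have [_ /(_ N0) hN2] := htb _ _ hN.
have [h1 _] := htb _ _ hs1; have [h2 _] := htb _ _ hs2.
have p : 0 < b2 / s2 - b1 / s1 by rewrite subr_gt0.
rewrite -(ger0_norm (ltW p)) E normrM normfV normrM.
have K1 : 1 <= K%:R :> R by rewrite ler1n.
have Kp : 0 < K%:R :> R by rewrite ltr0n.
apply: (@le_trans _ _ (K%:R ^- (8 * n + 3).+1 *
  (K%:R ^+ (4 * n).+2 * K%:R ^+ (4 * n).+2)^-1)).
  rewrite -exprD -invfM -exprD natrX -exprM lef_pV2 ?posrE ?exprn_gt0 //.
  by rewrite ler_weXn2l //; lia.
have sp : 0 < `|s1| * `|s2| by rewrite mulr_gt0 ?normr_gt0.
have kp : 0 < K%:R ^+ (4 * n).+2 * K%:R ^+ (4 * n).+2 :> R by rewrite mulr_gt0 ?exprn_gt0.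
have kN : 0 <= K%:R ^- (8 * n + 3).+1 :> R by rewrite ltW // invr_gt0 exprn_gt0.
have ki : 0 <= (K%:R ^+ (4 * n).+2 * K%:R ^+ (4 * n).+2)^-1 :> R by rewrite ltW // invr_gt0.
apply: (ler_pM kN ki hN2).
by rewrite lef_pV2 ?posrE //; apply: ler_pM.
Qed.

(** * Euclidean geometry of the unfolding *)

(* The product of the reflections along w depends only on these counts (and on
   the parity of the length), because the rotations among them commute. *)
Fixpoint occ (j : 'I_3) (w : seq 'I_3) : nat * nat :=
  if w is i :: w' then (((i == j) + (occ j w').2)%N, (occ j w').1) else (0, 0)%N.

Lemma occ_le j w : ((occ j w).1 <= size w)%N /\ ((occ j w).2 <= size w)%N.
Proof. by elim: w => [//|i w [h1 h2]] /=; case: (i == j); lia. Qed.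

Section Geometry.
Variables (R : rcfType) (X Y : 'I_3 -> R).

Definition sqlen j k := (X j - X k) ^+ 2 + (Y j - Y k) ^+ 2.
(** Twice the signed area. *)
Definition area (X Y : 'I_3 -> R) := (X (nx 0) - X 0) * (Y (pv 0) - Y 0)
  - (Y (nx 0) - Y 0) * (X (pv 0) - X 0).
Definition foot i := ((X (pv i) - X i) * (X (nx i) - X i)
  + (Y (pv i) - Y i) * (Y (nx i) - Y i)) / sqlen (nx i) i.
Hypothesis area_neq0 : area X Y != 0.

Local Notation step := (step foot).
Local Notation run := (run foot).
Local Notation good := (good foot).
Local Notation bary := (bary foot).

Lemma area_rot (U V : 'I_3 -> R) i : area U V = (U (nx i) - U i) * (V (pv i) - V i)
  - (V (nx i) - V i) * (U (pv i) - U i).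
Proof.
rewrite /area; case: (I3P 0 i) => -> //; rewrite ?I3E; ring.
Qed.

Lemma sqlen_ge0 j k : 0 <= sqlen j k.
Proof. by rewrite addr_ge0 ?sqr_ge0. Qed.

Lemma sqlen_gt0 i : 0 < sqlen (nx i) i.
Proof.
rewrite lt_neqAle sqlen_ge0 andbT eq_sym; apply: contraNneq area_neq0 => /eqP.
rewrite /sqlen paddr_eq0 ?sqr_ge0 // !sqrf_eq0 => /andP[/eqP x0 /eqP y0].
by rewrite (area_rot _ _ i) x0 y0 !mul0r subrr.
Qed.

(** [rc i] and [rs i] are the cosine and sine of twice the angle from the first axis to side [i],
    that is, the matrix entries of the reflection in this side. *)
Definition rc i := ((X (nx i) - X i) ^+ 2 - (Y (nx i) - Y i) ^+ 2) / sqlen (nx i) i.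
Definition rs i := 2 * (X (nx i) - X i) * (Y (nx i) - Y i) / sqlen (nx i) i.

Lemma rcs i : rc i ^+ 2 + rs i ^+ 2 = 1.
Proof.
have := sqlen_gt0 i; rewrite /rc /rs /sqlen => h; field; exact: lt0r_neq0.
Qed.

Lemma step_X i : step i X =1
  (fun j => rc i * X j + rs i * Y j + (X i - rc i * X i - rs i * Y i)).
Proof.
have n0 := lt0r_neq0 (sqlen_gt0 i).
move=> j; rewrite /step; case: eqP => [->|].
  by rewrite /foot /rc /rs; move: n0; rewrite /sqlen => n0; field.
case: (I3P i j) => -> // _; first ring.
by rewrite /rc /rs; move: n0; rewrite /sqlen => n0; field.
Qed.

Lemma step_Y i : step i Y =1
  (fun j => rs i * X j + - rc i * Y j + (Y i - rs i * X i + rc i * Y i)).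
Proof.
have n0 := lt0r_neq0 (sqlen_gt0 i).
move=> j; rewrite /step; case: eqP => [->|].
  by rewrite /foot /rc /rs; move: n0; rewrite /sqlen => n0; field.
case: (I3P i j) => -> // _; first ring.
by rewrite /rc /rs; move: n0; rewrite /sqlen => n0; field.
Qed.

(** Unfolding along [i :: w] is unfolding along [w] followed by the reflection in side [i] of the
    initial triangle. *)
Lemma run_consX i w j : run (i :: w) X j =
  rc i * run w X j + rs i * run w Y j + (X i - rc i * X i - rs i * Y i).
Proof. by rewrite /= (eq_run _ _ (step_X i)) run_lin. Qed.

Lemma run_consY i w j : run (i :: w) Y j =
  rs i * run w X j + - rc i * run w Y j + (Y i - rs i * X i + rc i * Y i).
Proof. by rewrite /= (eq_run _ _ (step_Y i)) run_lin. Qed.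

Lemma run_isometry w j k :
  (run w X j - run w X k) ^+ 2 + (run w Y j - run w Y k) ^+ 2 = sqlen j k.
Proof.
elim: w => [//|i w <-]; rewrite !run_consX !run_consY.
rewrite -[RHS]mul1r -(rcs i); ring.
Qed.

Lemma run_area w : area (run w X) (run w Y) ^+ 2 = area X Y ^+ 2.
Proof.
elim: w => [//|i w <-]; rewrite /area !run_consX !run_consY.
by rewrite -[RHS]mul1r -[1](expr1n _ 2) -{1}(rcs i); ring.
Qed.

Local Open Scope complex_scope.

Definition rot i : R[i] := rc i +i* rs i.

(** In the complex plane, reflection in side [i] sends a vector [z] to [rot i * conjc z]. Composing
    along [w] leaves the factor [hol w], and a conjugation if the length is odd. *)
Fixpoint hol (w : seq 'I_3) : R[i] :=
  if w is i :: w' then rot i * conjc (hol w') else 1.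

Lemma run_hol w u j k :
  (run (w ++ u) X j - run w X k) +i* (run (w ++ u) Y j - run w Y k) =
  hol w * iter (size w) conjc ((run u X j - X k) +i* (run u Y j - Y k)).
Proof.
elim: w => [|i w IH]; first by rewrite mul1r.
rewrite cat_cons !run_consX !run_consY /= -mulrA -(rmorphM (@conjc R)) -IH /rot.
apply/eqP; rewrite eq_complex /=; apply/andP; split; apply/eqP; ring.
Qed.

Lemma hol_occ w :
  hol w = \prod_j (rot j ^+ (occ j w).1 * conjc (rot j) ^+ (occ j w).2).
Proof.
elim: w => [|i w IH] /=; first by rewrite big1 // => j _; rewrite !expr0 mul1r.
have conjE (a : R[i]) m n : conjc (a ^+ m * conjc a ^+ n) = a ^+ n * conjc a ^+ m.
  by rewrite (rmorphM (@conjc R)) !(rmorphXn (@conjc R)) /= conjcK mulrC.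
rewrite IH (rmorph_prod (@conjc R)) /=.
under eq_bigr do rewrite conjE.
under [RHS]eq_bigr do rewrite exprD -mulrA.
rewrite [RHS]big_split /= [X in _ = X * _](bigD1 i) //= eqxx expr1.
rewrite [X in _ = _ * X * _]big1 ?mulr1 // => j ji.
by rewrite eq_sym (negPf ji).
Qed.

Lemma affine_coords (F : 'I_3 -> R) : exists a b c, F =1 (fun j => a * X j + b * Y j + c).
Proof.
pose a := ((F (nx 0) - F 0) * (Y (pv 0) - Y 0)
  - (F (pv 0) - F 0) * (Y (nx 0) - Y 0)) / area X Y.
pose b := ((F (pv 0) - F 0) * (X (nx 0) - X 0)
  - (F (nx 0) - F 0) * (X (pv 0) - X 0)) / area X Y.
exists a, b, (F 0 - a * X 0 - b * Y 0) => j.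
rewrite /a /b; move: area_neq0; rewrite /area => n0.
by case: (I3P 0 j) => ->; field.
Qed.

(** The vector between the two vertices is the image of a vector depending only on [u], [j], [k]
    under the linear part of the unfolding along [w], and this linear part is determined by the
    letter counts and the length. *)
Lemma run_diff_occ w w' u F j k : size w = size w' -> (forall l, occ l w = occ l w') ->
  run (w ++ u) F j - run w F k = run (w' ++ u) F j - run w' F k.
Proof.
move=> sw ow; have [a [b [c FE]]] := affine_coords F.
rewrite !(eq_run _ _ FE) !run_lin.
have := run_hol w u j k; have := run_hol w' u j k.
have -> : hol w' = hol w by rewrite !hol_occ; apply: eq_bigr => l _; rewrite ow.
rewrite sw => <- /eqP; rewrite eq_complex /= => /andP[/eqP ex /eqP ey].
rewrite -[RHS]addr0 (_ : _ - _ = a * (run (w ++ u) X j - run w X k) +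
  b * (run (w ++ u) Y j - run w Y k)); last by ring.
by rewrite ex ey; ring.
Qed.

Definition reach := \sum_j \sum_k (`|X j - X k| + `|Y j - Y k|).

Lemma reach_ge j k : `|X j - X k| + `|Y j - Y k| <= reach.
Proof.
rewrite /reach (bigD1 j) //= (bigD1 k) //= -addrA lerDl addr_ge0 //.
  by apply: sumr_ge0 => l _; rewrite addr_ge0.
by apply: sumr_ge0 => l _; apply: sumr_ge0 => m _; rewrite addr_ge0.
Qed.

Lemma reach_ge0 : 0 <= reach.
Proof. by apply: le_trans (reach_ge 0 0); rewrite addr_ge0. Qed.

Lemma sqlen_le j k : sqlen j k <= reach ^+ 2.
Proof.
apply: (@le_trans _ _ ((`|X j - X k| + `|Y j - Y k|) ^+ 2)).
  rewrite sqrrD !real_normK ?num_real // lerD2r lerDl.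
  by rewrite mulrn_wge0 // mulr_ge0.
by rewrite ler_sqr ?nnegrE ?addr_ge0 ?reach_ge0 ?reach_ge.
Qed.

Lemma run_edge_le w j k : `|run w X j - run w X k| <= reach /\
  `|run w Y j - run w Y k| <= reach.
Proof.
have h := sqlen_le j k; rewrite -(run_isometry w) in h.
move: (run w X j - run w X k) (run w Y j - run w Y k) h => x y h.
have x0 := sqr_ge0 x; have y0 := sqr_ge0 y.
have L (z : R) : z ^+ 2 <= reach ^+ 2 -> `|z| <= reach.
  by rewrite -[z ^+ 2]real_normK ?num_real // ler_sqr ?nnegrE ?reach_ge0.
by split; apply: L; apply: le_trans h; rewrite ?lerDl ?lerDr.
Qed.

Lemma run_le w j : `|run w X j| <= \sum_k `|X k| + reach * (size w)%:R /\
  `|run w Y j| <= \sum_k `|Y k| + reach * (size w)%:R.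
Proof.
elim/last_ind: w j => [|w a IH] j.
  have aux (U : 'I_3 -> R) : `|U j| <= \sum_k `|U k| + reach * 0%:R.
    by rewrite mulr0 addr0 (bigD1 j) //= lerDl sumr_ge0.
  by split; apply: aux.
rewrite size_rcons -natr1 mulrDr mulr1 !addrA.
have [xj yj] := IH j; have [xa ya] := IH a; have := reach_ge0.
have [ja r0|ja r0] := eqVneq j (pv a); last first.
  by rewrite !run_rcons /step (negPf ja); split; lra.
have [ex ey] := run_edge_le (rcons w a) j a.
have xa' : run (rcons w a) X a = run w X a by rewrite run_rcons step_cur.
have ya' : run (rcons w a) Y a = run w Y a by rewrite run_rcons step_cur.
rewrite xa' ya' in ex ey.
have tri (x y : R) : `|x| <= `|x - y| + `|y|.
  by have := ler_normD (x - y) y; rewrite subrK.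
by split; apply: le_trans (tri _ _) _; [apply: le_trans (lerD ex xa) _ |
  apply: le_trans (lerD ey ya) _]; rewrite addrC.
Qed.

(** Barycentric coordinates are affine functions of Cartesian ones, and these grow at most linearly:
    a reflected vertex stays within [reach] of a vertex that has not moved. *)
Lemma bary_le : exists2 C : R, 0 < C &
  forall w k j, `|bary w k j| <= C * (size w).+1%:R.
Proof.
have h k : exists2 C : R, 0 <= C & forall w j, `|bary w k j| <= C * (size w).+1%:R.
  have [a [b [c FE]]] := affine_coords (fun l => (l == k)%:R).
  exists (`|a| * (\sum_k `|X k| + reach) + `|b| * (\sum_k `|Y k| + reach) + `|c|).
    by rewrite !addr_ge0 ?mulr_ge0 ?addr_ge0 ?reach_ge0 ?sumr_ge0.
  move=> w j; rewrite /bary (eq_run _ _ FE) run_lin.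
  have [hx hy] := run_le w j.
  apply: le_trans (ler_normD _ _) _; rewrite [leRHS]mulrDl lerD //; last first.
    by rewrite ler_peMr // ler1n.
  apply: le_trans (ler_normD _ _) _; rewrite [leRHS]mulrDl lerD //.
    rewrite normrM -mulrA ler_wpM2l // (le_trans hx) // mulrDl lerD //.
      by rewrite ler_peMr ?ler1n ?sumr_ge0.
    by rewrite ler_wpM2l ?reach_ge0 // ler_nat.
  rewrite normrM -mulrA ler_wpM2l // (le_trans hy) // mulrDl lerD //.
    by rewrite ler_peMr ?ler1n ?sumr_ge0.
  by rewrite ler_wpM2l ?reach_ge0 // ler_nat.
have [C0 C00 h0] := h 0; have [C1 C10 h1] := h (nx 0); have [C2 C20 h2] := h (pv 0).
exists (C0 + C1 + C2 + 1); first by lra.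
move=> w k j.
have aux C : 0 <= C -> C <= C0 + C1 + C2 + 1 -> `|bary w k j| <= C * (size w).+1%:R ->
    `|bary w k j| <= (C0 + C1 + C2 + 1) * (size w).+1%:R.
  by move=> _ hC /le_trans; apply; rewrite ler_wpM2r.
by case: (I3P 0 k) aux => -> aux; [apply: (aux C0) | apply: (aux C1) | apply: (aux C2)];
  rewrite ?h0 ?h1 ?h2 //; lra.
Qed.

Lemma cauchy_schwarz2 (a b c d : R) :
  (a * d - b * c) ^+ 2 <= (a ^+ 2 + b ^+ 2) * (c ^+ 2 + d ^+ 2).
Proof.
rewrite -subr_ge0 (_ : _ - _ = (a * c + b * d) ^+ 2) ?sqr_ge0 //; ring.
Qed.

(** Since [area] is twice the area, dividing it by the longest side gives the smallest altitude;
    with [reach] in place of that side, this bounds the square of the altitude from below. *)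
Definition min_width2 := area X Y ^+ 2 / reach ^+ 2.

Lemma reach_gt0 : 0 < reach ^+ 2.
Proof. by apply: lt_le_trans (sqlen_gt0 0) (sqlen_le _ _). Qed.

Lemma min_width2_gt0 : 0 < min_width2.
Proof. by rewrite divr_gt0 ?reach_gt0 // exprn_even_gt0. Qed.

Lemma min_width2_le x y i w :
  (x * (run w Y (nx i) - run w Y (pv i)) - y * (run w X (nx i) - run w X (pv i))) ^+ 2 >=
  area X Y ^+ 2 -> min_width2 <= x ^+ 2 + y ^+ 2.
Proof.
move=> h; rewrite /min_width2 ler_pdivrMr ?reach_gt0 //.
apply: le_trans h _; apply: le_trans (cauchy_schwarz2 _ _ _ _) _.
rewrite run_isometry ler_wpM2l ?sqlen_le // addr_ge0 ?sqr_ge0 //.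
Qed.

Lemma sqlen_ge j k : j != k -> min_width2 <= sqlen j k.
Proof.
move=> jk; case: (neqI3 jk) => ->.
- apply: (@min_width2_le _ _ j [::]) => /=.
  rewrite (area_rot _ _ j) le_eqVlt; apply/orP; left; apply/eqP.
  by congr (_ ^+ 2); ring.
- apply: (@min_width2_le _ _ j [::]) => /=.
  rewrite (area_rot _ _ j) le_eqVlt; apply/orP; left; apply/eqP.
  by congr (_ ^+ 2); ring.
Qed.

(* The first vertex o and the last vertex of an unfolded strip are separated by
   the line through the side facing o, unless they belong to a common triangle. *)
Lemma apex_far u x o F : u != [::] -> norep u -> good F u ->
  run u F (apex u) = 0 ->
  min_width2 <= (run (x ++ u) X (apex u) - run x X o) ^+ 2 +
                (run (x ++ u) Y (apex u) - run x Y o) ^+ 2.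
Proof.
elim: u x F => [//|a u IH] x F _ nr gF F0.
have [ao|ao] := eqVneq (pv a) o.
  have := beyond_first_side nr gF F0; rewrite ao.
  set z := apex (a :: u); move=> m0.
  have s1 := run_bary_sum foot (a :: u) z.
  apply: (@min_width2_le _ _ o x); rewrite -(run_area x).
  rewrite !run_cat (run_bary _ (a :: u) (run x X)) (run_bary _ (a :: u) (run x Y)).
  move: s1 m0; rewrite !(sum_I3 _ o) (area_rot _ _ o).
  set m := run (a :: u); move: (m _ z) (m _ z) (m _ z) => m3 m2 m1 s1 m0.
  have {s1} -> : m3 = 1 - m1 - m2 by lra.
  set U := run x X; set V := run x Y.
  (* The cross product of the vector with the side opposite to [o] is, up to sign, [1 - m1] times
     [area], and [m1 < 0]. *)
  rewrite [leRHS](_ : _ = (1 - m1) ^+ 2 * ((U (nx o) - U o) * (V (pv o) - V o) -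
   (V (nx o) - V o) * (U (pv o) - U o)) ^+ 2); last by ring.
  rewrite ler_peMl ?sqr_ge0 //; nra.
(* Here crossing [a] leaves [o] in place. Either both vertices lie in the triangle so entered, or
   [a] is moved to the prefix. *)
case: u IH nr gF F0 => [|b u] IH nr gF F0.
  rewrite cats1.
  have -> : run x X o = run (rcons x a) X o by rewrite run_rcons /step eq_sym (negPf ao).
  have -> : run x Y o = run (rcons x a) Y o by rewrite run_rcons /step eq_sym (negPf ao).
  by rewrite run_isometry sqlen_ge.
have -> : run x X o = run (rcons x a) X o by rewrite run_rcons /step eq_sym (negPf ao).
have -> : run x Y o = run (rcons x a) Y o by rewrite run_rcons /step eq_sym (negPf ao).
rewrite -cat_rcons; apply: (IH (rcons x a) (step a F)) => //.
- by case/andP: nr.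
- by case: gF.
Qed.

End Geometry.

(** * The vector between two splitting vertices *)

Section GapValue.
Variables (R : realFieldType) (q : 'I_3 -> R).

(** The linear part of the ray functional, evaluated on the vector from the vertex splitting [x] to
    the one splitting [x ++ u]. It is affine in [t] and vanishes when the ray is parallel to this
    vector. *)
Definition gap_value (x u : seq 'I_3) (t : R) :=
  run q (x ++ u) (ray (head 0 x) t) (apex (x ++ u)) - run q x (ray (head 0 x) t) (apex x).

Definition gap_slope x u := gap_value x u 1 - gap_value x u 0.

Lemma gap_valueE x u s t : gap_value x u t = gap_value x u s + gap_slope x u * (t - s).
Proof.
rewrite /gap_slope /gap_value !run_ray.
move: (bary _ _ _ _) (bary _ _ _ _) (bary _ _ _ _) (bary _ _ _ _) => a b c d; ring.
Qed.

End GapValue.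

Lemma norep_cat (x u : seq 'I_3) : norep (x ++ u) -> norep u.
Proof.
by case: x => [//|a x]; rewrite /norep /= cat_path => /andP[_ /path_sorted].
Qed.

Section Gap.
Variables (R : rcfType) (X Y : 'I_3 -> R).
Hypothesis area_neq0 : area X Y != 0.
Local Notation run := (run (foot X Y)).
Local Notation bary := (bary (foot X Y)).
Local Notation reach := (reach X Y).

Lemma run_diff_bary (w w' : seq 'I_3) j k h : exists n1 n2, forall F,
  run w F j - run w' F k = n1 * (F h - F (pv h)) + n2 * (F (nx h) - F (pv h)).
Proof.
exists (bary w h j - bary w' h k), (bary w (nx h) j - bary w' (nx h) k) => F.
rewrite [run w F j]run_bary [run w' F k]run_bary.
have := run_bary_sum (foot X Y) w j; have := run_bary_sum (foot X Y) w' k.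
rewrite !(sum_I3 _ h) /bary.
set a1 := run w _ _; set a2 := run w _ _; set a3 := run w _ _.
set b1 := run w' _ _; set b2 := run w' _ _; set b3 := run w' _ _.
move: a1 a2 a3 b1 b2 b3 => a1 a2 a3 b1 b2 b3 e1 e2.
have -> : a3 = 1 - a1 - a2 by lra.
have -> : b3 = 1 - b1 - b2 by lra.
ring.
Qed.

(** Slope and value at [t] determine the coordinates [n1], [n2] of the vector in the basis of two
    sides of the triangle, so both cannot be small while [apex_far] bounds the length below. *)
Lemma gap_ge : exists2 c : R, 0 < c & forall x u t, split (foot X Y) x ->
  split (foot X Y) (x ++ u) -> u != [::] -> 0 <= t <= 1 ->
  c <= `|gap_slope (foot X Y) x u| + `|gap_value (foot X Y) x u t|.
Proof.
have r0 := reach_gt0 area_neq0; have w0 := min_width2_gt0 area_neq0.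
(* The factor 18 is [2 * 3 ^ 2]: two Cartesian coordinates, and [S <= 3 * T] below. *)
pose k := min_width2 X Y / (18 * reach ^+ 2).
have k0 : 0 < k by rewrite divr_gt0 // mulr_gt0.
have kE : k * (18 * reach ^+ 2) = min_width2 X Y.
  by rewrite divfK // mulf_neq0 // lt0r_neq0.
(* The argument gives [k <= T ^+ 2]; the square of [k / (1 + k)] is at most [k], which avoids a
   square root. *)
exists (k / (1 + k)); first by rewrite divr_gt0 // addr_gt0.
move=> x u t [x0 _ _] /[dup] sxu /splitW[_ nr _] u0 t01.
have [s] := split_zero sxu; rewrite good_cat => -[_ gu] zu.
have h := apex_far area_neq0 x (apex x) u0 (norep_cat nr) gu.
have au : apex u = apex (x ++ u) by rewrite /apex last_cat; case: (u) u0.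
rewrite au -run_cat in h; have {zu}h := h zu.
have [n1 [n2 nuE]] := run_diff_bary (x ++ u) x (apex (x ++ u)) (apex x) (head 0 x).
rewrite !nuE in h.
have vE r : gap_value (foot X Y) x u r = n1 * r + n2 * (r - 1).
  by rewrite /gap_value nuE /ray !I3E !subr0.
have bE : gap_slope (foot X Y) x u = n1 + n2.
  by rewrite /gap_slope !vE; ring.
move: (gap_slope _ _ _) bE => B bE; move: (gap_value _ _ _ _) (vE t) => v {}vE.
set a := X _ - X _ in h; set b := X _ - X _ in h.
set a' := Y _ - Y _ in h; set b' := Y _ - Y _ in h.
have hab (i j : 'I_3) : `|X i - X j| <= reach /\ `|Y i - Y j| <= reach.
  have := reach_ge X Y i j; have := normr_ge0 (X i - X j).
  have := normr_ge0 (Y i - Y j); lra.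
have [ha ha'] : `|a| <= reach /\ `|a'| <= reach by apply: hab.
have [hb hb'] : `|b| <= reach /\ `|b'| <= reach by apply: hab.
have rr := reach_ge0 X Y.
move: reach (min_width2 X Y) a a' b b' rr r0 w0 @k k0 kE ha ha' hb hb' h.
move=> L W a a' b b' rr r0 w0 k k0 kE ha ha' hb hb' h {hab nuE}.
pose S := `|n1| + `|n2|; pose T := `|B| + `|v|.
have T0 : 0 <= T by rewrite addr_ge0.
have S0 : 0 <= S by rewrite addr_ge0.
have ST : S <= 3 * T.
  have n2E : n2 = t * B - v by rewrite vE bE; ring.
  have n1E : n1 = B - n2 by rewrite bE; ring.
  have a2 : `|n2| <= T.
    rewrite n2E (le_trans (ler_normB _ _)) // lerD2r normrM ler_piMl //.
    by rewrite ger0_norm; lra.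
  have a1 : `|n1| <= `|B| + `|n2| by rewrite n1E ler_normB.
  have : 0 <= `|v| by [].
  by rewrite /S; move: a1 a2; rewrite /T; lra.
have edge y z : `|y| <= L -> `|z| <= L -> (n1 * y + n2 * z) ^+ 2 <= (L * S) ^+ 2.
  move=> hy hz; rewrite -[leLHS]real_normK ?num_real //.
  rewrite ler_sqr ?nnegrE ?mulr_ge0 //.
  rewrite (le_trans (ler_normD _ _)) // !normrM /S mulrDr !(mulrC L) lerD //.
    by rewrite ler_wpM2l.
  by rewrite ler_wpM2l.
have h1 : W <= 2 * (L * S) ^+ 2.
  by apply: le_trans h _; have := edge _ _ ha hb; have := edge _ _ ha' hb'; lra.
have kT : k <= T ^+ 2.
  have : k * (18 * L ^+ 2) <= T ^+ 2 * (18 * L ^+ 2).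
    rewrite kE; apply: le_trans h1 _.
    rewrite (_ : T ^+ 2 * _ = 2 * (L ^+ 2 * (3 * T) ^+ 2)); last by ring.
    rewrite exprMn ler_wpM2l // ler_wpM2l ?sqr_ge0 // ler_sqr ?nnegrE //.
    by rewrite mulr_ge0.
  by rewrite ler_pM2r // mulr_gt0.
have k1 : 0 <= k / (1 + k) by apply: divr_ge0; lra.
rewrite -/T -ler_sqr ?nnegrE //.
apply: le_trans kT; rewrite expr_div_n ler_pdivrMr; last by rewrite exprn_gt0 ?addr_gt0.
nra.
Qed.

End Gap.

(** * Counting *)

Lemma card_le_rel (T I : finType) (A : {set T}) (rel : T -> I -> Prop) :
  (forall x, x \in A -> exists i, rel x i) ->
  (forall x y i, x \in A -> y \in A -> rel x i -> rel y i -> x = y) ->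
  (#|A| <= #|I|)%N.
Proof.
move=> relE relI.
have [i0|noI] := pselect (exists i : I, True); last first.
  rewrite (_ : A = finset.set0) ?cards0 //; apply/finset.setP => x; rewrite finset.in_set0.
  by apply/negP => /relE[i _]; apply: noI; exists i.
have /choice[f fP] : forall x : T, exists i, x \in A -> rel x i.
  move=> x; have [/relE[i xi]|_] := boolP (x \in A); first by exists i.
  by case: i0 => i _; exists i.
rewrite -(card_in_imset (f := f)) ?max_card // => x y xA yA fxy.
by apply: (relI _ _ (f x)) => //; [apply: fP | rewrite fxy; apply: fP].
Qed.

Section Counting.
Variables (R : realFieldType) (q : 'I_3 -> R).

Definition lang (w : seq 'I_3) := norep w /\ exists F, good q F w.
Definition langs n := [set w : n.-tuple 'I_3 | `[< lang w >]].
Definition cones n := [set w : n.-tuple 'I_3 | `[< cone q w >]].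

(** Deleting the first letter is at most two-to-one, and by [left_special] a word with two preimages
    is read by a ray from a vertex. *)
Lemma card_langsS n : (#|langs n.+2| <= #|langs n.+1| + #|cones n.+1|)%N.
Proof.
pose I : finType := ({w | w \in langs n.+1} + {w | w \in cones n.+1})%type.
have -> : (#|langs n.+1| + #|cones n.+1|)%N = #|I|.
  by rewrite card_sum !card_sig.
(* The right summand is used for one of the two extensions, the one by [pv], and only when the
   extension by [nx] exists too. *)
pose rel (w : n.+2.-tuple 'I_3) (i : I) := match i with
  | inl x => val (val x) = behead w /\
      (head 0 w = nx (head 0 (behead w)) \/
       head 0 w = pv (head 0 (behead w)) /\ ~ lang (nx (head 0 (behead w)) :: behead w))
  | inr x => val (val x) = behead w /\
      (head 0 w = pv (head 0 (behead w)) /\ lang (nx (head 0 (behead w)) :: behead w))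
  end.
have hd (w : n.+2.-tuple 'I_3) : w \in langs n.+2 ->
    head 0 w = nx (head 0 (behead w)) \/ head 0 w = pv (head 0 (behead w)).
  rewrite finset.inE => /asboolP[+ _]; case/tupleP: w => a w; case/tupleP: w => b w /=.
  by move=> /andP[ab _]; rewrite eq_sym in ab; apply: neqI3.
apply: (card_le_rel (rel := rel)).
- move=> w wL; have w1 : behead_tuple w \in langs n.+1.
    move: wL; rewrite !finset.inE => /asboolP[nr [F gF]]; apply/asboolP; split.
      by move: nr; case/tupleP: w gF => a w _ /path_sorted.
    by case/tupleP: w gF {nr} => a w /= [_ gF]; eexists; exact: gF.
  have [h|h] := hd _ wL; first by exists (inl (Sub (behead_tuple w) w1)); split=> //; left.
  have [l|l] := pselect (lang (nx (head 0 (behead w)) :: behead w)); last first.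
    by exists (inl (Sub (behead_tuple w) w1)); split=> //; right.
  suff w2 : behead_tuple w \in cones n.+1 by exists (inr (Sub (behead_tuple w) w2)).
  rewrite finset.inE; apply/asboolP; move: w1 wL.
  rewrite !finset.inE => /asboolP[nr _] /asboolP[_ gF].
  move: h l gF nr; case/tupleP: w => a w; case/tupleP: w => b w /=.
  by move=> -> [_ g1] g2 nr; apply: left_special.
- move=> w w' [[x xP]|[x xP]] wL wL' /= [e1 h1] [e2 h2]; apply: val_inj => /=.
  + have bb : behead w = behead w' by rewrite -e1 -e2.
    have lw v : v \in langs n.+2 -> lang (head 0 v :: behead v).
      by rewrite finset.inE => /asboolP; case/tupleP: v.
    have hh : head 0 w = head 0 w'.
      case: h1 h2 => [n1|[p1 nl]] [n2|[p2 nl']]; rewrite ?n1 ?p1 ?n2 ?p2 ?bb //.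
      * by case: nl'; rewrite -bb -n1; apply: lw.
      * by case: nl; rewrite bb -n2; apply: lw.
    move: bb hh; case/tupleP: w {wL e1 h1} => a w.
    by case/tupleP: w' {wL' e2 h2} => a' w' /= -> ->.
  + have bb : behead w = behead w' by rewrite -e1 -e2.
    have hh : head 0 w = head 0 w' by rewrite h1.1 h2.1 bb.
    move: bb hh; case/tupleP: w {wL e1 h1} => a w.
    by case/tupleP: w' {wL' e2 h2} => a' w' /= -> ->.
Qed.

End Counting.

(** * Coding a word by its choices at splits *)

Section Coding.
Variables (R : realFieldType) (q : 'I_3 -> R).
Local Notation cone := (cone q).
Local Notation split := (split q).

Lemma split_intro x a b : x != [::] -> cone (rcons x a) -> cone (rcons x b) ->
  a != b -> split x.
Proof.
move=> x0 ca cb; have [_ na _] := ca; have [_ nb _] := cb.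
have := norep_last x0 na; have := norep_last x0 nb; set l := last 0 x.
move=> /neqI3[] eb /neqI3[] ea; rewrite ea eb ?eqxx // => _; split=> //.
- by rewrite -/l -eb.
- by rewrite -/l -ea.
- by rewrite -/l -ea.
- by rewrite -/l -eb.
Qed.

Lemma cone_take w p : cone w -> (0 < p)%N -> cone (take p w).
Proof.
move=> cw p0; apply: (@cone_cat _ q _ (drop p w)); last by rewrite cat_take_drop.
by case: cw; case: w p p0 => // a w [].
Qed.

Definition sparse (g k : nat) (w : seq 'I_3) := forall i j,
  (k < i)%N -> (i < j)%N -> (j < size w)%N -> split (take i w) ->
  split (take j w) -> (g < j - i)%N.

(** Letters after a prefix that is not a split are forced. Beyond position [k], each block of [g]
    consecutive positions contains at most one split, so one letter per block suffices, together
    with the prefix and the letter at [k]. *)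
Lemma card_sparse n g k (Y : {set k.-tuple 'I_3}) (W : {set n.-tuple 'I_3}) :
  (0 < g)%N -> (k < n)%N ->
  (forall w, w \in W -> [/\ cone w, sparse g k w &
    exists2 y, y \in Y & val y = take k w]) ->
  (#|W| <= #|Y| * 3 ^ (n %/ g).+2)%N.
Proof.
move=> g0 kn WP.
pose I : finType := ({y | y \in Y} * 'I_3 * {ffun 'I_(n %/ g).+1 -> 'I_3})%type.
have -> : (#|Y| * 3 ^ (n %/ g).+2)%N = #|I|.
  by rewrite !card_prod card_sig card_ffun !card_ord expnS mulnA.
pose rel (w : n.-tuple 'I_3) (i : I) :=
  [/\ val (val i.1.1) = take k w, i.1.2 = nth 0 w k &
   forall p, (k < p < n)%N -> split (take p w) -> i.2 (inord (p %/ g)%N) = nth 0 w p].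
apply: (card_le_rel (rel := rel)).
  move=> w /WP[cw sw [y yY ye]].
  pose f0 (b : 'I_(n %/ g).+1) : 'I_3 :=
    if [pick p : 'I_n | [&& (k < p)%N, `[< split (take p w) >] & (p %/ g == b)%N]] is Some p
    then nth 0 w p else 0.
  pose f : {ffun 'I_(n %/ g).+1 -> 'I_3} := finfun f0.
  exists (Sub y yY, nth 0 w k : 'I_3, f); split=> //= p /andP[kp pn] sp.
  rewrite /f ffunE /f0 inordK ?ltnS ?leq_div2r ?(ltnW pn) //.
  case: pickP => [p' /and3P[kp' /asboolP sp' /eqP e]|/(_ (Ordinal pn))]; last first.
    by rewrite /= kp eqxx asboolT.
  have blk i j : (i %/ g = j %/ g)%N -> (i < j)%N -> (g < j - i)%N -> False.
    move=> eij ij; have := ltn_pmod j g0.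
    have := divn_eq j g; have := divn_eq i g; rewrite eij; move: (_ * g)%N => m; lia.
  case: (ltngtP p p') => [lt|gt|-> //].
  - by case: (blk p p' (esym e) lt); apply: sw sp sp'; rewrite ?size_tuple.
  - by case: (blk p' p e gt); apply: sw sp' sp; rewrite ?size_tuple.
move=> w w' i /WP[cw _ _] /WP[cw' _ _] [y1 a1 c1] [y2 a2 c2]; apply: val_inj => /=.
suff H p : (p <= n)%N -> take p w = take p w'.
  by have := H n (leqnn n); rewrite !take_oversize ?size_tuple.
elim: p => [|p IH] pn; first by rewrite !take0.
have [pk|kp] := ltnP p k.
  have := congr1 (take p.+1) (etrans (esym y1) y2).
  by rewrite !take_takel.
rewrite !(take_nth 0) ?size_tuple // IH ?(ltnW pn) //; congr (rcons _ _).
move: kp; rewrite leq_eqVlt => /orP[/eqP <-|kp]; first by rewrite -a1 -a2.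
(* If the next letters differed, the common prefix would be a split and both letters would be
   recorded in the code. *)
apply/eqP; apply: contraTT isT => ne.
have cp : cone (rcons (take p w) (nth 0 w p)).
  by rewrite -take_nth ?size_tuple //; apply: cone_take.
have cp' : cone (rcons (take p w) (nth 0 w' p)).
  by rewrite IH ?(ltnW pn) // -take_nth ?size_tuple //; apply: cone_take.
have t0 : take p w != [::].
  by rewrite -size_eq0 size_takel ?size_tuple ?(ltnW pn) // -lt0n (leq_ltn_trans _ kp).
have sp := split_intro t0 cp cp' ne.
have pP : (k < p < n)%N by rewrite kp.
move: ne; rewrite -(c1 p pP sp) -(c2 p pP) ?eqxx //.
by rewrite -IH // ltnW.
Qed.

Lemma card_bigcup_le (T I : finType) (F : I -> {set T}) :
  (#|\bigcup_i F i| <= \sum_i #|F i|)%N.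
Proof.
elim/big_rec2: _ => [|i m A _ h]; first by rewrite cards0.
by apply: leq_trans (leq_card_setU _ _) _; rewrite leq_add2l.
Qed.

Definition close_splits k l := [set x : k.-tuple 'I_3 |
  `[< split x /\ exists u : l.-tuple 'I_3, split (x ++ u) >]].

(** Either no two splits are within distance [g], or the last such pair begins at some [k], and the
    word is [sparse] after it. The word is then coded by its prefix of length [k] and its later
    choices. *)
Lemma card_cones_le n g : (0 < g)%N -> (0 < n)%N ->
  (#|cones q n| <= (1 + \sum_(k < n) \sum_(l < g) #|close_splits k l.+1|) *
    3 ^ (n %/ g).+2)%N.
Proof.
move=> g0 n0.
pose W0 := [set w : n.-tuple 'I_3 | `[< cone w /\ sparse g 0 w >]].
pose WP (k : 'I_n) (l : 'I_g) (w : n.-tuple 'I_3) := [/\ cone w, sparse g k w &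
  exists2 y, y \in close_splits k l.+1 & val y = take k w].
pose W (k : 'I_n) (l : 'I_g) := [set w : n.-tuple 'I_3 | `[< WP k l w >]].
have sub : cones q n \subset W0 :|: \bigcup_k \bigcup_l W k l.
  apply/fintype.subsetP => w; rewrite !finset.inE => /asboolP cw.
  have [s0|ns] := pselect (sparse g 0 w); first by rewrite asboolT.
  (* [bad i] says that a close pair begins at [i]; the largest such [i] is taken. *)
  pose bad i := `[< exists j, [/\ (0 < i)%N, (i < j < n)%N, (j - i <= g)%N,
    split (take i w) & split (take j w)] >].
  have badE : exists i, bad i.
    apply: contrapT => nb; apply: ns => i j i0 ij; rewrite size_tuple => jn si sj.
    rewrite ltnNge; apply/negP => h; apply: nb; exists i; apply/asboolP; exists j.
    by split=> //; rewrite ij.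
  have badn i : bad i -> (i <= n)%N by move=> /asboolP[j [_ ij _ _ _]]; lia.
  apply/orP; right.
  case: (ex_maxnP badE badn) => i /asboolP[j [i0 /andP[ij jn] jig si sj]] imax.
  have iln : (i < n)%N by lia.
  have jl : ((j - i).-1 < g)%N by lia.
  apply/finset.bigcupP; exists (Ordinal iln) => //.
  apply/finset.bigcupP; exists (Ordinal jl) => //.
  rewrite finset.inE; apply/asboolP; split=> //=.
    move=> a b ia ab; rewrite size_tuple => bn sa sb; rewrite ltnNge; apply/negP => h.
    suff /imax : bad a by lia.
    by apply/asboolP; exists b; split=> //; lia.
  have st : size (take i w) == i by rewrite size_takel ?size_tuple ?(ltnW iln).
  exists (Tuple st) => //; rewrite finset.inE; apply/asboolP; split=> //=.
  have e : (j - i).-1.+1 = (j - i)%N by lia.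
  have su : size (take (j - i) (drop i w)) == (j - i).-1.+1.
    by rewrite size_takel ?e // size_drop size_tuple; lia.
  exists (Tuple su) => /=; rewrite (_ : _ ++ _ = take j w) //.
  by rewrite -{2}(subnKC (ltnW ij)) takeD.
apply: leq_trans (subset_leq_card sub) _; apply: leq_trans (leq_card_setU _ _) _.
rewrite mulnDl leq_add //.
  rewrite mul1n; apply: leq_trans (card_sparse (Y := finset.setT) g0 n0 _) _.
    move=> w; rewrite finset.inE => /asboolP[cw sw]; split=> //.
    by exists [tuple] => //; rewrite take0.
  by rewrite cardsT card_tuple expn0 mul1n.
rewrite big_distrl; apply: leq_trans (card_bigcup_le _) _; apply: leq_sum => k _.
rewrite big_distrl; apply: leq_trans (card_bigcup_le _) _; apply: leq_sum => l _.
by apply: card_sparse => // w; rewrite finset.inE => /asboolP.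
Qed.

End Coding.

(** * Locating intervals of directions on dyadic grids *)

Lemma floor_eq_dist (R : realType) (x y : R) : Num.floor x = Num.floor y -> `|x - y| < 1.
Proof.
move=> e; have /andP[h1 h2] := floor_itv x; have /andP[h3 h4] := floor_itv y.
rewrite e in h1 h2; rewrite intrD in h2 h4; rewrite ltr_norml; apply/andP; split; lra.
Qed.

Lemma floor_dist_le (R : realType) (x y : R) (B : nat) : `|x - y| <= B%:R ->
  `|Num.floor x - Num.floor y| <= B.+1%:R.
Proof.
have /andP[h1 h2] := floor_itv x; have /andP[h3 h4] := floor_itv y.
rewrite intrD in h2 h4; rewrite ler_norml => /andP[h5 h6].
apply: ltW; rewrite -(ltr_int R) intr_norm rmorph_nat intrB -natr1 ltr_norml.
by apply/andP; split; lra.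
Qed.

Lemma dyadic_scale (R : realType) (a : R) (m : nat) : a <= 1 -> 2 ^- m <= a ->
  exists s : nat, [/\ (s <= m)%N, 2 ^- s <= a & a < 2 * 2 ^- s].
Proof.
move=> a1 ma; pose P s := 2 ^- s <= a.
have exP : exists s, P s by exists m.
case: (ex_minnP exP) => s sP smin; exists s; split=> //; first exact: smin.
case: s sP smin => [|s] sP smin; first by rewrite expr0 invr1; lra.
rewrite [2 ^+ s.+1]exprS invfM mulVKf ?pnatr_eq0 // ltNge; apply/negP => h.
by have := smin s h; rewrite ltnn.
Qed.

Section Close.
Variables (R : realType) (q : 'I_3 -> R).
Local Notation cone := (cone q).
Local Notation split := (split q).
Local Notation good := (good q).

Definition is_interval x (z1 z2 : R) :=
  forall t, good (ray (head 0 x) t) x <-> z1 < t < z2.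

(** Two intervals of length at least [2 ^- s] whose midpoints lie in one cell of mesh [2 ^- s]
    overlap, and a common ray reads only one word of the given length. *)
Lemma interval_inj (x x' : seq 'I_3) (z1 z2 z1' z2' : R) (s : nat) :
  x != [::] -> norep x -> norep x' -> size x = size x' -> head 0 x = head 0 x' ->
  is_interval x z1 z2 -> is_interval x' z1' z2' ->
  2 ^- s <= z2 - z1 -> 2 ^- s <= z2' - z1' ->
  Num.floor ((z1 + z2) / 2 * 2 ^+ s) = Num.floor ((z1' + z2') / 2 * 2 ^+ s) ->
  x = x'.
Proof.
move=> x0 nr nr' sx hx zP zP' sz sz' /floor_eq_dist.
have s0 : 0 < 2 ^+ s :> R by rewrite exprn_gt0.
rewrite -mulrBl normrM (ger0_norm (ltW s0)) -ltr_pdivlMr // mul1r ltr_norml.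
have i0 : 0 < 2 ^- s :> R by rewrite invr_gt0.
move=> /andP[h1 h2].
pose t := (Num.max z1 z1' + Num.min z2 z2') / 2.
have [t1 t2] : z1 < t < z2 /\ z1' < t < z2'.
  by rewrite /t; case: (leP z1 z1'); case: (leP z2 z2') => ? ?; lra.
by apply: (ray_inj (q := q) (t := t)) => //; [apply/zP | apply/zP'].
Qed.

(** The parameter of the ray parallel to the vector between the two splitting vertices. It has this
    meaning when the slope is nonzero, as in the case [b = true] below. *)
Definition gap_root x u := - gap_value q x u 0 / gap_slope q x u.

Variables (C c : R).
Hypotheses (C0 : 0 < C) (c0 : 0 < c).
Hypothesis Cb : forall w k j, `|bary q w k j| <= C * (size w).+1%:R.
Hypothesis cg : forall x u t, split x -> split (x ++ u) -> u != [::] -> 0 <= t <= 1 ->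
  c <= `|gap_slope q x u| + `|gap_value q x u t|.

(* Both split vertices are swept inside the parameter interval of x, so that the
   direction of the vector between them nearly belongs to this interval. *)
Lemma close_to_root x u z1 z2 (s D : nat) : 8 * C / c + 2 <= D%:R ->
  split x -> split (x ++ u) -> u != [::] -> 0 <= z1 -> z2 <= 1 ->
  is_interval x z1 z2 -> 2 ^- s <= z2 - z1 -> z2 - z1 < 2 * 2 ^- s ->
  exists b : bool, `|Num.floor ((z1 + z2) / 2 * 2 ^+ s) -
    (if b then Num.floor (gap_root x u * 2 ^+ s) else 0)| <=
    (D * (size x + size u).+1).+1%:R.
Proof.
move=> hD sx sxu u0 z1_ge0 z2_le1 zP sz sz'.
set n := (size x + size u).+1.
have x0 : x != [::] by case: sx.
have [t gt t0] := split_zero sx; have tz := gt; rewrite zP in tz.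
have [t' gt' t'0] := split_zero sxu.
have hd : head 0 (x ++ u) = head 0 x by case: (x) x0.
rewrite hd in gt' t'0.
have tz' : z1 < t' < z2 by apply/zP; move: gt'; rewrite good_cat => -[].
have s0 : 0 < 2 ^+ s :> R by rewrite exprn_gt0.
have s2 : (z2 - z1) * 2 ^+ s < 2 by rewrite -ltr_pdivlMr.
have s1 : 1 <= (z2 - z1) * 2 ^+ s by rewrite -ler_pdivrMr // mul1r.
have n1 : 1 <= n%:R :> R by rewrite ler1n.
(* At [t] the ray passes through the first vertex, at [t'] through the second. The gap at [t] is
   thus the variation between [t'] and [t] of the value at the second vertex, with slope at most
   [2 * C * n]. *)
have gv : `|gap_value q x u t| <= 2 * C * n%:R * (z2 - z1).
  rewrite /gap_value t0 subr0 -[run _ _ _ _]subr0 -t'0 !run_ray.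
  have b1 := Cb (x ++ u) (head 0 x) (apex (x ++ u)).
  have b2 := Cb (x ++ u) (nx (head 0 x)) (apex (x ++ u)).
  rewrite size_cat -/n in b1 b2.
  move: (bary _ _ _ _) (bary _ _ _ _) b1 b2 => a b b1 b2.
  have -> : t * (b + a) - a - (t' * (b + a) - a) = (b + a) * (t - t') by ring.
  rewrite normrM ler_pM //.
    by have := ler_normD b a; lra.
  by rewrite ler_norml; lra.
have t01 : 0 <= t <= 1 by lra.
have h := cg sx sxu u0 t01.
have D0 : 8 * C / c * c = 8 * C by rewrite divfK // gt_eqF.
have E0 : 0 <= 8 * C / c by rewrite divr_ge0 ?mulr_ge0 // ltW.
set E := 8 * C / c in D0 E0 hD.
(* For a short interval the slope is at least [c / 2], so the root is close to [t]. *)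
have [small|big] := leP (2 * C * n%:R * (z2 - z1)) (c / 2).
  exists true; apply: floor_dist_le; rewrite -mulrBl normrM (ger0_norm (ltW s0)).
  have B0 : c / 2 <= `|gap_slope q x u| by lra.
  have Bn0 : gap_slope q x u != 0.
    by rewrite -normr_gt0 (lt_le_trans _ B0) // divr_gt0.
  have rE : gap_value q x u t = gap_slope q x u * (t - gap_root x u).
    rewrite (gap_valueE q x u 0 t) /gap_root subr0; move: (gap_slope _ _ _) Bn0 => B Bn0.
    by move: (gap_value _ _ _ _) => v; field.
  rewrite rE normrM in gv.
  have d1 : `|t - gap_root x u| * c <= 4 * C * n%:R * (z2 - z1).
    have := normr_ge0 (t - gap_root x u); move: `|t - _| `|gap_slope _ _ _| gv B0.
    move=> d B gv B0 d0; nra.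
  have {d1}d1 : `|t - gap_root x u| <= E / 2 * n%:R * (z2 - z1).
    rewrite -(ler_pM2r c0); apply: le_trans d1 _.
    by rewrite le_eqVlt; apply/orP; left; apply/eqP; move: D0; nra.
  have d2 : `|(z1 + z2) / 2 - gap_root x u| <= (E / 2 * n%:R + 1) * (z2 - z1).
    have -> : (z1 + z2) / 2 - gap_root x u = ((z1 + z2) / 2 - t) + (t - gap_root x u) by ring.
    apply: le_trans (ler_normD _ _) _.
    have : `|(z1 + z2) / 2 - t| <= z2 - z1 by rewrite ler_norml; lra.
    by move: d1; lra.
  apply: (@le_trans _ _ ((E / 2 * n%:R + 1) * (z2 - z1) * 2 ^+ s)).
    by rewrite ler_pM2r.
  rewrite -mulrA natrM; apply: (@le_trans _ _ ((E / 2 * n%:R + 1) * 2)).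
    rewrite ler_wpM2l // ?(ltW s2) // addr_ge0 // mulr_ge0 // divr_ge0 //.
  apply: (@le_trans _ _ ((E + 2) * n%:R)); last by rewrite ler_wpM2r.
  rewrite mulrDl mulrDl mulrAC divfK ?pnatr_eq0 //; lra.
(* A long interval makes [2 ^+ s] at most of order [n], so the cell index itself is small. *)
exists false; rewrite -(@floor0 R); apply: floor_dist_le; rewrite subr0 ger0_norm; last first.
  by apply: mulr_ge0; [lra | exact: ltW].
have a1 : (z1 + z2) / 2 * 2 ^+ s <= 2 ^+ s by rewrite ger_pMl //; lra.
apply: le_trans a1 _; rewrite natrM.
have : c * 2 ^+ s <= 8 * C * n%:R.
  have := mulr_ge0 (ltW C0) (ler0n R n); set p := C * n%:R => p0.
  have : c / 2 * 2 ^+ s < 2 * p * ((z2 - z1) * 2 ^+ s).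
    by rewrite mulrA ltr_pM2r // /p mulrA.
  have : 2 * p * ((z2 - z1) * 2 ^+ s) <= 2 * p * 2.
    by rewrite ler_wpM2l ?(ltW s2) // mulr_ge0.
  by rewrite -[8 * C * _]mulrA -/p; lra.
rewrite -D0 mulrAC [_ * c]mulrC ler_pM2l // => h1; apply: le_trans h1 _.
by rewrite ler_wpM2r //; lra.
Qed.

Hypothesis run_diff : forall w w' u F j k, size w = size w' ->
  (forall l, occ l w = occ l w') ->
  run q (w ++ u) F j - run q w F k = run q (w' ++ u) F j - run q w' F k.
Variable K : nat.
Hypotheses (K0 : (0 < K)%N) (Kg : forall w z1 z2, endpoint q w z1 ->
    endpoint q w z2 -> z1 < z2 -> K%:R ^- (size w).+1 <= z2 - z1).

Lemma gap_value_eq x x' u t : u != [::] -> size x = size x' ->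
  (forall l, occ l x = occ l x') -> head 0 x = head 0 x' -> last 0 x = last 0 x' ->
  gap_value q x u t = gap_value q x' u t.
Proof.
move=> u0 sx ox hx lx; rewrite /gap_value /apex !last_cat lx hx.
by case: u u0 => // a u _; apply: run_diff.
Qed.

(** The word [u], the end letters and the letter counts of [x] determine [gap_root x u]. A scale and
    an offset of linear size then locate the interval of [x], which determines [x] by
    [interval_inj]. *)
Lemma card_close_splits : exists A : nat, forall k l, (0 < l)%N ->
  (#|close_splits q k l| <= A * (k + l).+1 ^ 8 * #|langs q l|)%N.
Proof.
pose D := (Num.truncn (8 * C / c + 2)).+1.
have hD : 8 * C / c + 2 <= D%:R by rewrite ltW // truncnS_gt.
exists (18 * K.+1 * (2 * D + 4))%N => k l l0; set n := (k + l).+1.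
pose N := (D * n).+1.
(* In order: first and last letters, letter counts, [u], dyadic scale, case of [close_to_root],
   offset. The six counts give [n ^ 6]; scale and offset give one factor [n] each, up to
   constants. *)
pose I : finType := ('I_3 * 'I_3 * {ffun 'I_3 -> 'I_n * 'I_n} * {u | u \in langs q l} *
  'I_(K * n).+1 * bool * 'I_(2 * N).+1)%type.
apply: (@leq_trans #|I|); last first.
  rewrite !card_prod card_sig card_ffun card_prod !card_ord card_bool.
  rewrite /N; set L := #|_|.
  have : ((2 * (D * n).+1).+1 <= (2 * D + 4) * n)%N by rewrite /n; nia.
  have : ((K * n).+1 <= K.+1 * n)%N by rewrite /n; nia.
  move: (K * n).+1 (2 * _).+1 => a b ha hb.
  apply: (@leq_trans (3 * 3 * (n * n) ^ 3 * L * (K.+1 * n) * 2 * ((2 * D + 4) * n))).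
    by rewrite !leq_mul.
  by apply/eq_leq; move: (2 * D + 4)%N K.+1 => d K1; ring.
pose rel (x : k.-tuple 'I_3) (i : I) :=
  let: (h, o, f, u, s, b, m) := i in
  [/\ x != [::] :> seq _ /\ norep x, head 0 x = h /\ last 0 x = o,
   forall j, occ j x = (val (f j).1, val (f j).2) &
   exists z1 z2, [/\ is_interval x z1 z2, 2 ^- s <= z2 - z1 &
     Num.floor ((z1 + z2) / 2 * 2 ^+ s) -
     (if b then Num.floor (gap_root x (val u) * 2 ^+ s) else 0) = m%:Z - N%:Z]].
apply: (card_le_rel (rel := rel)).
  move=> x; rewrite finset.inE => /asboolP[sx [u sxu]].
  have x0 : x != [::] :> seq _ by case: sx.
  have [z1 [z2 [z1_ge0 z12 z2_le1 [e1 e2] zP]]] := cone_interval (splitW sx).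
  have Kz := Kg e1 e2 z12; rewrite size_tuple in Kz.
  have Kz2 : 2 ^- (K * n) <= z2 - z1.
    apply: le_trans Kz; rewrite exprM lef_pV2 ?posrE ?exprn_gt0 ?ltr0n //.
    rewrite -!natrX ler_nat; apply: (@leq_trans (K ^ n)).
      by rewrite leq_pexp2l // /n ltnS leq_addr.
    by rewrite leq_exp2r // ltnW // ltn_expl.
  have z1z2 : z2 - z1 <= 1 by lra.
  have [s [sK sz sz']] := dyadic_scale z1z2 Kz2.
  have u0 : u != [::] :> seq _ by rewrite -size_eq0 size_tuple -lt0n.
  have [b bP] := close_to_root hD sx sxu u0 z1_ge0 z2_le1 zP sz sz'.
  rewrite !size_tuple -/n -/N in bP.
  have uL : u \in langs q l.
    rewrite finset.inE; apply/asboolP; have [_ nr [t gt]] := splitW sxu; split.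
      exact: norep_cat nr.
    by eexists; move: gt; rewrite good_cat => -[_]; exact.
  set v := Num.floor _ - _ in bP.
  have oK j : ((occ j x).1 < n)%N /\ ((occ j x).2 < n)%N.
    have [h1 h2] := occ_le j x; rewrite size_tuple in h1 h2.
    by rewrite /n !ltnS !(leq_trans _ (leq_addr l k)).
  pose f : {ffun 'I_3 -> 'I_n * 'I_n} :=
    finfun (fun j => (Ordinal (oK j).1, Ordinal (oK j).2)).
  have mP : (`|(v + N%:Z)%R| < (2 * N).+1)%N.
    by move: bP; rewrite ler_norml => /andP[]; clear; lia.
  have sP : (s < (K * n).+1)%N by [].
  exists (head 0 x, last 0 x, f, Sub u uL, Ordinal sP, b, Ordinal mP).
  split=> //.
  - by split=> //; case: (splitW sx).
  - by move=> j; rewrite /f ffunE /= -surjective_pairing.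
  exists z1, z2; split=> //=; rewrite -/v.
  by move: bP; rewrite ler_norml => /andP[]; clear; lia.
move=> x y [[[[[[h o] f] u] s] b] m] _ _.
move=> [[x0 nrx] [hx lx] ox [z1 [z2 [zP sz fz]]]].
move=> [[y0 nry] [hy ly] oy [w1 [w2 [wP sw fw]]]].
apply: val_inj; apply: (interval_inj x0 nrx nry _ _ zP wP sz sw).
- by rewrite !size_tuple.
- by rewrite hx hy.
have u0 : val u != [::] :> seq _ by rewrite -size_eq0 size_tuple -lt0n.
have root_eq : gap_root x (val u) = gap_root y (val u).
  have E t : gap_value q x (val u) t = gap_value q y (val u) t.
    apply: gap_value_eq => //; rewrite ?size_tuple ?hx ?lx //.
    by move=> j; rewrite ox oy.
  by rewrite /gap_root /gap_slope !E.
by move: fw; rewrite -fz root_eq => /addIr.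
Qed.

End Close.

(** * Growth of the language when the length doubles *)

Section Growth.
Local Open Scope nat_scope.
Variables (R : realFieldType) (q : 'I_3 -> R) (A : nat).
Hypothesis close_le : forall k l, 0 < l ->
  #|close_splits q k l| <= A * (k + l).+1 ^ 8 * #|langs q l|.

Definition langs_upto n := \sum_(l < n.+1) #|langs q l|.

Lemma langs_upto_gt0 n : 0 < langs_upto n.
Proof.
rewrite /langs_upto big_ord_recl; apply: ltn_addr; apply/card_gt0P.
exists [tuple]; rewrite finset.inE; apply/asboolP; split=> //.
by exists (fun _ => 0%R).
Qed.

(** Close splits only involve words of length at most [g], so lengths up to [2 * g] are controlled
    by [langs_upto g]. *)
Lemma card_cones_doubling g n : 0 < g -> 0 < n <= 2 * g ->
  #|cones q n| <= 81 * (1 + 2 * 3 ^ 8 * A) * g ^ 9 * langs_upto g.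
Proof.
move=> g0 /andP[n0 ng]; apply: leq_trans (card_cones_le q g0 n0) _.
set S := \sum_(k < n) _; pose L := langs_upto g.
have hS : S <= 2 * g * (A * (3 * g) ^ 8 * L).
  have hk (k : 'I_n) : \sum_(l < g) #|close_splits q k l.+1| <= A * (3 * g) ^ 8 * L.
    rewrite /L /langs_upto big_ord_recl mulnDr (leq_trans _ (leq_addl _ _)) //.
    rewrite big_distrr; apply: leq_sum => l _ /=.
    apply: leq_trans (@close_le k l.+1 isT) _; rewrite leq_mul // leq_mul //.
    by rewrite leq_exp2r //; have := ltn_ord k; have := ltn_ord l; lia.
  apply: (@leq_trans (\sum_(k < n) A * (3 * g) ^ 8 * L)).
    by apply: leq_sum => k _; apply: hk.
  by rewrite sum_nat_const card_ord leq_mul.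
(* Since [n %/ g] is at most 2, the exponent is at most 4. *)
have h3 : 3 ^ (n %/ g).+2 <= 81.
  have : n %/ g <= 2 by rewrite -(mulnK 2 g0) leq_div2r.
  by move=> h; rewrite (@leq_pexp2l 3 _ 4).
apply: leq_trans (leq_mul (leq_add (leqnn 1) hS) h3) _.
have L0 : 0 < L := langs_upto_gt0 g; rewrite -/L.
have g9 : 0 < g ^ 9 * L by rewrite muln_gt0 expn_gt0 g0.
rewrite (_ : 2 * g * _ = 2 * 3 ^ 8 * A * (g ^ 9 * L)); last by ring.
rewrite -(mulnA _ (g ^ 9)); move: (g ^ 9 * L) (2 * 3 ^ 8 * A) g9 => x y x0.
by rewrite mulnC -mulnA leq_mul2l mulnDl mul1n leq_add2r.
Qed.

Lemma card_langs_le3 n : n <= 1 -> #|langs q n| <= 3.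
Proof.
move=> n1; apply: leq_trans (max_card _) _; rewrite card_tuple card_ord.
by case: n n1 => [|[]].
Qed.

Lemma langs_upto_double g : 0 < g ->
  langs_upto (2 * g) <= 3 * (3 + 2 * (81 * (1 + 2 * 3 ^ 8 * A))) * g ^ 11 * langs_upto g.
Proof.
move=> g0; set A1 := 81 * _; pose B := A1 * g ^ 9 * langs_upto g.
have hL n : n <= 2 * g -> #|langs q n| <= 3 + n * B.
  elim: n => [_|[|n] IH ng].
  - by rewrite (leq_trans (card_langs_le3 _)) // leq_addr.
  - by rewrite (leq_trans (card_langs_le3 _)) // leq_addr.
  apply: leq_trans (card_langsS q n) _.
  have -> : 3 + n.+2 * B = (3 + n.+1 * B) + B by ring.
  apply: leq_add; first by apply: IH; apply: ltnW.
  by apply: card_cones_doubling => //; apply: ltnW.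
have : langs_upto (2 * g) <= \sum_(l < (2 * g).+1) (3 + 2 * g * B).
  apply: leq_sum => l _; apply: leq_trans (hL l _) _; first by rewrite -ltnS.
  by rewrite leq_add2l leq_mul2r -ltnS ltn_ord orbT.
move=> /leq_trans; apply; rewrite sum_nat_const card_ord /B {B hL}.
have L0 := langs_upto_gt0 g; move: (langs_upto g) L0 => L L0.
have h1 : (2 * g).+1 <= 3 * g by lia.
have h2 : 3 + 2 * g * (A1 * g ^ 9 * L) <= (3 + 2 * A1) * (g ^ 10 * L).
  rewrite (_ : 2 * g * _ = 2 * A1 * (g ^ 10 * L)); last by ring.
  have : 0 < g ^ 10 * L by rewrite muln_gt0 expn_gt0 g0.
  by move: (g ^ 10 * L) A1 => x y x0; nia.
by apply: leq_trans (leq_mul h1 h2) _; apply/eq_leq; ring.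
Qed.

(** Passing from [2 ^ j] to twice that length costs a factor at most [M ^ j.+1]; adding these
    exponents gives a quadratic in [j]. *)
Lemma langs_upto_pow : exists M, forall j, langs_upto (2 ^ j) <= M ^ j.+1 ^ 2.
Proof.
set A2 := 3 * (3 + 2 * (81 * (1 + 2 * 3 ^ 8 * A))).
exists (4 * A2 * 2 ^ 11) => j; set M := 4 * _ * _.
have A20 : 0 < A2 by rewrite muln_gt0 addn_gt0.
have M0 : 0 < M by rewrite /M muln_gt0 muln_gt0 A20.
elim: j => [|j IH].
  rewrite expn0 /langs_upto !big_ord_recl big_ord0 addn0.
  apply: (@leq_trans (3 + 3)); first by apply: leq_add; apply: card_langs_le3.
  rewrite exp1n expn1 /M; apply: (@leq_trans (4 * (3 * 3) * 1)); first by [].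
  apply: leq_mul; last by rewrite expn_gt0.
  apply: leq_mul; first by [].
  by apply: leq_mul; [|exact: leq_addr].
rewrite expnS; apply: leq_trans (langs_upto_double _) _; first by rewrite expn_gt0.
rewrite -/A2; apply: (@leq_trans (M ^ j.+1 * M ^ j.+1 ^ 2)).
  rewrite leq_mul //; apply: (@leq_trans (A2 * (2 ^ 11) ^ j)).
    by rewrite -!expnM (mulnC 11).
  rewrite /M expnMn leq_mul //.
    by rewrite expnS -{1}(muln1 A2) leq_mul ?expn_gt0 ?A20 // leq_pmull.
  by rewrite leq_pexp2l.
by rewrite -expnD leq_pexp2l //; nia.
Qed.

End Growth.

(** * Billiard words *)

Section Billiard.
Local Open Scope classical_set_scope.
Variables (R : realType) (v : 'I_3 -> 'rV[R]_2).

Definition vX j := v j 0 0.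
Definition vY j := v j 0 1.
Local Notation q := (foot vX vY).

Lemma dotE (u w : 'rV[R]_2) : dot u w = u 0 0 * w 0 0 + u 0 1 * w 0 1.
Proof.
rewrite /dot !big_ord_recl big_ord0 addr0.
by have -> : lift ord0 ord0 = 1 :> 'I_2 by apply: val_inj.
Qed.

Definition cross (u w : 'rV[R]_2) := u 0 0 * w 0 1 - u 0 1 * w 0 0.

Lemma row2_eq (u w : 'rV[R]_2) : u 0 0 = w 0 0 -> u 0 1 = w 0 1 -> u = w.
Proof.
move=> h0 h1; apply/rowP => j; case: (ltngtP j 1) => [j0|j2|j1].
- by have -> : j = 0 by apply: val_inj => /=; lia.
- by have := ltn_ord j; lia.
- by have -> : j = 1 by apply: val_inj.
Qed.

Lemma noncollinear_area : noncollinear v -> area vX vY != 0.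
Proof.
rewrite /noncollinear free_cons span_seq1 seq1_free => /andP[ab b0].
apply: contra ab => /eqP; rewrite /area /vX /vY => a0.
have [x0|x0] := eqVneq ((v (ord_pred 0) - v 0) 0 0) 0.
  have [y0|y0] := eqVneq ((v (ord_pred 0) - v 0) 0 1) 0.
    by case/eqP: b0; apply: row2_eq; rewrite ?x0 ?y0 mxE.
  apply/vlineP; exists ((v (ordS 0) - v 0) 0 1 / (v (ord_pred 0) - v 0) 0 1).
  apply: row2_eq; rewrite [RHS]mxE; last by rewrite divfK.
  rewrite x0 mulr0; apply: (mulIf y0); rewrite mul0r.
  by move: x0 a0; rewrite !mxE => ->; rewrite mulr0 subr0.
apply/vlineP; exists ((v (ordS 0) - v 0) 0 0 / (v (ord_pred 0) - v 0) 0 0).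
apply: row2_eq; rewrite [RHS]mxE; first by rewrite divfK.
rewrite mulrAC; apply: (mulIf x0); rewrite divfK //.
by move: a0 x0; rewrite !mxE => /eqP; rewrite subr_eq0 => /eqP ->.
Qed.

Hypothesis area_neq0 : area vX vY != 0.

(** From a point on the line of side [i], a small move away from the vertex [pv i] would make the
    barycentric coordinate at [pv i] negative and leave the triangle. *)
Lemma interior_cross p i : (triangle v)° p -> cross (side_dir v i) (p - v i) != 0.
Proof.
move=> /nbhs_ballP[e /= e0 pe]; apply/eqP => c0.
pose n := v i - v (pv i).
pose s := e / 2 / (`|n| + 1).
have n1 : 0 < `|n| + 1 by rewrite ltr_wpDl.
have s0 : 0 < s by rewrite !divr_gt0.
have : triangle v (p + s *: n).
  apply: pe; rewrite -ball_normE /= opprD addNKr normrN normrZ gtr0_norm //.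
  have : s * (`|n| + 1) = e / 2 by rewrite /s divfK // gt_eqF.
  rewrite mulrDr mulr1; move: (s * _) => y; lra.
move=> [l [l0 l1 E]].
have EX : p 0 0 + s * (vX i - vX (pv i)) = \sum_k l k * vX k.
  have := congr1 (fun M : 'rV_2 => M 0 0) E.
  by rewrite !mxE summxE => ->; apply: eq_bigr => k _; rewrite mxE.
have EY : p 0 1 + s * (vY i - vY (pv i)) = \sum_k l k * vY k.
  have := congr1 (fun M : 'rV_2 => M 0 1) E.
  by rewrite !mxE summxE => ->; apply: eq_bigr => k _; rewrite mxE.
move: c0; rewrite /cross /side_dir !mxE -!/(vX _) -!/(vY _) => c0.
have ar := area_neq0; rewrite (area_rot _ _ i) in ar.
move: l1 EX EY (l0 (pv i)); rewrite !(sum_I3 _ i).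
move: (l i) (l (nx i)) (l (pv i)) => a b c abc EX EY c_ge0.
have : (c + s) * ((vX (nx i) - vX i) * (vY (pv i) - vY i) -
  (vY (nx i) - vY i) * (vX (pv i) - vX i)) = 0.
  have ea : a = 1 - b - c by lra.
  rewrite -[RHS]c0 -[p 0 0](addrK (s * (vX i - vX (pv i)))) EX.
  by rewrite -[p 0 1](addrK (s * (vY i - vY (pv i)))) EY ea; ring.
by move/eqP; rewrite mulf_eq0 (negPf ar) orbF => /eqP; lra.
Qed.

(** A velocity parallel to the side would keep the whole segment before the hit on the line of this
    side, which contains no interior point. *)
Lemma hit_not_parallel x u i w : orbit_codes v x u (i :: w) ->
  cross u (side_dir v i) != 0.
Proof.
move=> [t [t0 inT [s _ E] _]]; have /inT/(interior_cross i) : 0 < t / 2 < t by lra.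
apply: contra => /eqP c0; apply/eqP.
have EX : vX i + s * side_dir v i 0 0 = x 0 0 + t * u 0 0.
  by have := congr1 (fun M : 'rV_2 => M 0 0) E; rewrite !mxE.
have EY : vY i + s * side_dir v i 0 1 = x 0 1 + t * u 0 1.
  by have := congr1 (fun M : 'rV_2 => M 0 1) E; rewrite !mxE.
move: c0 EX EY; rewrite /cross /side_dir !mxE -!/(vX _) -!/(vY _).
move: (x 0 0) (x 0 1) (u 0 0) (u 0 1) => x0 x1 u0 u1 c0 EX EY.
have -> : x0 = vX i + s * (vX (ordS i) - vX i) - t * u0 by lra.
have -> : x1 = vY i + s * (vY (ordS i) - vY i) - t * u1 by lra.
apply: etrans (_ : _ = t / 2 * (u0 * (vY (ordS i) - vY i) - u1 * (vX (ordS i) - vX i))) _.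
  by field.
by rewrite c0 mulr0.
Qed.

(** The functional vanishes on the line of the orbit. Reflecting the velocity instead of the table
    turns [step i] of it into its opposite, which reads the same words by [good_opp]. *)
Lemma orbit_good x u w : orbit_codes v x u w ->
  good q (fun j => cross u (v j - x)) w.
Proof.
elim: w x u => [//|i w IH] x u oc; have np := hit_not_parallel oc.
case: oc => t [t0 _ [s]]; rewrite /= in_itv /= => /andP[s0 s1] E /IH gw.
have EX : vX i + s * (vX (nx i) - vX i) = x 0 0 + t * u 0 0.
  by have := congr1 (fun M : 'rV_2 => M 0 0) E; rewrite !mxE.
have EY : vY i + s * (vY (nx i) - vY i) = x 0 1 + t * u 0 1.
  by have := congr1 (fun M : 'rV_2 => M 0 1) E; rewrite !mxE.
have n0 := lt0r_neq0 (sqlen_gt0 area_neq0 i); rewrite /sqlen in n0.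
move: np; rewrite /cross /side_dir !mxE -!/(vX _) -!/(vY _) => np.
split.
  rewrite -!/(vX _) -!/(vY _).
  move: (x 0 0) (x 0 1) (u 0 0) (u 0 1) np EX EY => x0 x1 u0 u1 np EX EY.
  have -> : x0 = vX i + s * (vX (nx i) - vX i) - t * u0 by lra.
  have -> : x1 = vY i + s * (vY (nx i) - vY i) - t * u1 by lra.
  set p := u0 * _ - _ in np.
  (* With the hit at parameter [s] of the side, the values at its ends are [- s * p] and
     [(1 - s) * p]. *)
  apply: (@le_lt_trans _ _ (- (s * (1 - s) * p ^+ 2))).
    by rewrite /p le_eqVlt; apply/orP; left; apply/eqP; ring.
  by rewrite oppr_lt0 mulr_gt0 ?exprn_even_gt0 // mulr_gt0 // subr_gt0.
apply: (eq_good _ (good_opp gw)) => j.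
rewrite /step /reflect_side !dotE /side_dir /cross !mxE /foot /sqlen -!/(vX _) -!/(vY _).
move: (x 0 0) (x 0 1) (u 0 0) (u 0 1) EX EY => x0 x1 u0 u1 EX EY {E np gw IH}.
have -> : x0 = vX i + s * (vX (nx i) - vX i) - t * u0 by lra.
have -> : x1 = vY i + s * (vY (nx i) - vY i) - t * u1 by lra.
move: n0; case: (I3P i j) => ->; rewrite !I3E; move: (vX i) (vX (nx i)) (vX (pv i))
  (vY i) (vY (nx i)) (vY (pv i)) => a b c d f g n0.
- by field; rewrite ?n0.
- by field; rewrite ?n0.
- by field; rewrite ?n0.
Qed.

(** Between two successive hits of one side the velocity would be parallel to it, contrary to
    [hit_not_parallel]. *)
Lemma orbit_norep x u w : orbit_codes v x u w -> norep w.
Proof.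
elim: w x u => [//|i [//|j w] IH] x u oc.
case: oc => t [t0 _ [s _ E] oc].
have nr := IH _ _ oc; rewrite /norep /= -/(norep (j :: w)) in nr *; rewrite nr andbT.
apply/eqP => ij; rewrite -ij in oc => {nr}.
have /eqP := hit_not_parallel oc; apply.
case: oc; move: (reflect_side v i u) => u' t' [t'0 _ [s' _ E'] _].
have e k : t' * u' 0 k = (s' - s) * side_dir v i 0 k.
  have := congr1 (fun M : 'rV_2 => M 0 k) E'; have := congr1 (fun M : 'rV_2 => M 0 k) E.
  rewrite !mxE; lra.
apply: (mulfI (lt0r_neq0 t'0)); rewrite mulr0 /cross mulrBr !mulrA !e; ring.
Qed.

Lemma billiard_lang w : billiard_language v w -> lang q w.
Proof.
move=> [x [u [_ _ oc]]]; split; first exact: orbit_norep oc.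
by eexists; apply: orbit_good oc.
Qed.

End Billiard.

(** * Algebraicity of the reflection coefficients *)

Section Angles.
Local Open Scope classical_set_scope.
Variables (R : realType) (v : 'I_3 -> 'rV[R]_2).
Local Notation X := (vX v).
Local Notation Y := (vY v).
Hypothesis area_neq0 : area X Y != 0.

Lemma angle_cos_sin (u w : 'rV[R]_2) : 0 < dot u u -> 0 < dot w w ->
  cos (angle u w) * (enorm u * enorm w) = dot u w /\
  sin (angle u w) * (enorm u * enorm w) = `|cross u w|.
Proof.
move=> u0 w0.
have [nu nw] : 0 < enorm u /\ 0 < enorm w by rewrite !sqrtr_gt0.
have N0 : 0 < enorm u * enorm w by rewrite mulr_gt0.
have N2 : (enorm u * enorm w) ^+ 2 = dot u w ^+ 2 + cross u w ^+ 2.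
  by rewrite exprMn !sqr_sqrtr ?ltW // !dotE /cross; ring.
set x := dot u w / (enorm u * enorm w).
have xE : x * (enorm u * enorm w) = dot u w by rewrite divfK // gt_eqF.
have x1 : -1 <= x <= 1.
  rewrite -ler_norml -(ler_pM2r N0) mul1r -{1}(ger0_norm (ltW N0)) -normrM xE.
  rewrite -ler_sqr ?nnegrE ?(ltW N0) // N2 real_normK ?num_real //.
  by rewrite lerDl sqr_ge0.
split; first by rewrite /angle acosK // in_itv.
have x2 : 0 <= 1 - x ^+ 2.
  have /andP[h1 h2] := x1; rewrite (_ : 1 - x ^+ 2 = (1 - x) * (1 + x)); last by ring.
  by apply: mulr_ge0; lra.
rewrite /angle -/x sin_acos // -(sqrtr_sqr (cross u w)) -{1}(ger0_norm (ltW N0)).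
rewrite -(sqrtr_sqr (enorm u * enorm w)) -sqrtrM //; congr Num.sqrt.
by rewrite mulrBl mul1r -exprMn xE N2 addrC addKr.
Qed.

(** By the law of sines, [foot X Y i] is the cosine of the angle at [i] times the sine of the angle
    at [nx i], divided by the sine of the angle at [pv i]. *)
Lemma foot_algebraic : (forall i, trig_algebraic (interior_angle v i)) ->
  forall i, algebraicOver ratr (foot X Y i).
Proof.
move=> alg i.
pose l i := enorm (side_dir v i).
have d0 j : 0 < dot (side_dir v j) (side_dir v j).
  by have := sqlen_gt0 area_neq0 j; rewrite dotE /side_dir !mxE -!expr2.
have l0 j : 0 < l j by rewrite sqrtr_gt0.
have opp j : side_dir v (pv j) = - (v (pv j) - v j).
  by rewrite /side_dir (@ord_predK 3) opprB.
have lE j : enorm (v (pv j) - v j) = l (pv j).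
  by rewrite /l opp /enorm !dotE !mxE !mulrNN.
have cs j : cos (interior_angle v j) * (l j * l (pv j)) =
      dot (side_dir v j) (v (pv j) - v j) /\
    sin (interior_angle v j) * (l j * l (pv j)) = `|area X Y|.
  rewrite -lE; have dp : 0 < dot (v (pv j) - v j) (v (pv j) - v j).
    by have := d0 (pv j); rewrite opp !dotE !mxE !mulrNN.
  have [-> ->] := angle_cos_sin (d0 j) dp; split=> //.
  by rewrite (area_rot _ _ j) /cross /side_dir !mxE.
have [sn _] := alg (nx i); have [sp _] := alg (pv i); have [_ ci] := alg i.
suff E : foot X Y i = cos (interior_angle v i) * sin (interior_angle v (nx i)) /
    sin (interior_angle v (pv i)).
  by rewrite E; apply: algebraic_div => //; apply: algebraic_mul.
have [ci' _] := cs i; have [_ sn'] := cs (nx i); have [_ sp'] := cs (pv i).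
rewrite ?I3E in sn' sp'.
have A0 : 0 < `|area X Y| by rewrite normr_gt0.
have sp0 : sin (interior_angle v (pv i)) != 0.
  by apply: contraTneq A0 => e; rewrite -sp' e mul0r ltxx.
have n0 := lt0r_neq0 (sqlen_gt0 area_neq0 i).
have l2 : sqlen X Y (nx i) i = l i ^+ 2.
  by rewrite /l sqr_sqrtr ?ltW // dotE /side_dir !mxE -!expr2.
have fE : foot X Y i = cos (interior_angle v i) * (l i * l (pv i)) / l i ^+ 2.
  by rewrite ci' -l2 /foot dotE /side_dir !mxE; congr (_ / _); rewrite -!/(X _) -!/(Y _); ring.
have rel : sin (interior_angle v (nx i)) * l i = sin (interior_angle v (pv i)) * l (pv i).
  apply: (mulIf (lt0r_neq0 (l0 (nx i)))); rewrite -!mulrA.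
  by rewrite [l i * _]mulrC sn' -sp'.
rewrite fE; apply: (mulIf sp0); rewrite divfK // -mulrA [_ / _]mulrC.
have li := lt0r_neq0 (l0 i).
move: rel li; move: (l i) (l (pv i)) => a b rel li.
by rewrite -[RHS]mulr1 -(divff li) -mulrA [_ * (a / a)]mulrA rel; field.
Qed.

Lemma trig_algebraic_angles (a b : R) : trig_algebraic a -> trig_algebraic b ->
  interior_angle v 0 = a -> interior_angle v 1 = b ->
  interior_angle v 2 = pi - a - b -> forall i, trig_algebraic (interior_angle v i).
Proof.
move=> [sa ca] [sb cb] e0 e1 e2 i; case: (I3P 0 i) => ->.
- by rewrite e0.
- by rewrite (_ : nx 0 = 1) ?e1; [|apply: val_inj].
rewrite (_ : pv 0 = 2) ?e2; last exact: val_inj.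
have -> : pi - a - b = - (a + b) + pi by ring.
rewrite /trig_algebraic sinDpi cosDpi sinN cosN opprK sinD cosD; split.
  by apply: algebraic_add; apply: algebraic_mul.
by apply: algebraic_opp; apply: algebraic_sub; apply: algebraic_mul.
Qed.

End Angles.

(** * Squares of logarithms against powers of [n] *)

Lemma sq_le_cube (R : realType) (P c x : R) : 0 <= P -> 0 < c -> 0 <= x ->
  P * x ^+ 2 <= c * x ^+ 3 + P * (P / c) ^+ 2.
Proof.
move=> P0 c0 x0; have [h|h] := leP (P / c) x.
  apply: (@le_trans _ _ (c * x ^+ 3)).
    rewrite [x ^+ 3]exprS mulrA ler_wpM2r ?sqr_ge0 //.
    by move: h; rewrite ler_pdivrMr // mulrC.
  by rewrite lerDl mulr_ge0 // sqr_ge0.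
apply: (@le_trans _ _ (P * (P / c) ^+ 2)).
  have c1 := ltW c0; rewrite ler_wpM2l // ler_sqr ?nnegrE ?divr_ge0 //.
  exact: ltW.
by rewrite lerDr mulr_ge0 ?exprn_ge0 // ltW.
Qed.

(** With [2 ^ k] the largest power of 2 below or equal to [n], the logarithm of [p n] is at most
    quadratic in [k], while [n] to the power [eps] is at least cubic in [k]. *)
Lemma quasi_polynomial_bound (R : realType) (p L : nat -> nat) (M : nat) (eps : R) :
  0 < eps -> (forall m n, (m <= n)%N -> (p m <= L n)%N) ->
  (forall j, (L (2 ^ j) <= M ^ j.+1 ^ 2)%N) -> (p 0 <= 1)%N ->
  exists C : R, forall n, (p n)%:R < C * expR (n%:R `^ eps).
Proof.
move=> eps0 pL LM p0.
(* The successor makes the logarithm nonnegative, also when [M] is 0. *)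
pose a : R := ln M.+1%:R.
have a0 : 0 <= a by rewrite ln_ge0 // ler1n.
(* This is the coefficient of [k ^ 3] in the cubic term of the exponential series at
   [eps * ln 2 * k]. *)
pose c := (eps * ln 2) ^+ 3 / 6.
have ln2 : 0 < ln 2 :> R by rewrite ln_gt0 // ltr1n.
have c0 : 0 < c by rewrite divr_gt0 // exprn_gt0 // mulr_gt0.
pose D := 4 * a + 9 * a * (9 * a / c) ^+ 2.
(* [D] collects the constants from [(k + 2) ^ 2 <= 9 * k ^ 2 + 4] and from [sq_le_cube]; the added 1
   makes the inequality strict. *)
exists (expR D + 1) => n.
have D1 : 0 < expR D by apply: expR_gt0.
have [->|n0] := posnP n.
  have e1 : 1 <= expR (0%:R `^ eps : R) by rewrite -(expR0 R) ler_expR powR_ge0.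
  have pn : (p 0)%:R <= 1 :> R by rewrite lern1.
  nra.
pose k := trunc_log 2 n.
have /andP[kn nk] := trunc_log_bounds (isT : 1 < 2)%N n0.
have h1 : (p n)%:R <= expR (a * (k.+2 ^ 2)%:R).
  rewrite expRM_natr lnK ?posrE ?ltr0n // -natrX ler_nat.
  apply: leq_trans (pL _ _ (ltnW nk)) _; apply: leq_trans (LM _) _.
  by rewrite leq_exp2r // expn_gt0.
have x0 : 0 <= eps * ln 2 * k%:R by rewrite !mulr_ge0 // ltW.
have h2 : c * k%:R ^+ 3 <= n%:R `^ eps.
  rewrite /powR pnatr_eq0 (negPf (lt0n_neq0 n0)).
  apply: (@le_trans _ _ (expR (eps * ln 2 * k%:R))).
    apply: le_trans (expR_ge1Dxn 2 x0); rewrite exprMn /c.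
    have -> : 3`!%:R = 6 :> R by [].
    by rewrite mulrAC lerDr.
  rewrite ler_expR -mulrA ler_pM2l // mulr_natr -lnXn // ler_ln ?posrE ?ltr0n //.
  by rewrite -natrX ler_nat.
have h3 : a * (k.+2 ^ 2)%:R <= c * k%:R ^+ 3 + D.
  have h9 : (k.+2 ^ 2 <= 9 * k ^ 2 + 4)%N by nia.
  apply: (@le_trans _ _ (a * (9 * k ^ 2 + 4)%:R)); first by rewrite ler_wpM2l // ler_nat.
  have a9 : 0 <= 9 * a by rewrite mulr_ge0.
  have := sq_le_cube a9 c0 (ler0n R k).
  rewrite /D natrD natrM natrX; lra.
apply: le_lt_trans h1 _; apply: (@le_lt_trans _ _ (expR D * expR (n%:R `^ eps))).
  by rewrite -expRD ler_expR; lra.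
by rewrite ltr_pM2r ?expR_gt0 // ltrDl.
Qed.

Theorem corollary1p8 (R : realType) (alpha beta : R)
    (alpha_gt0 : 0 < alpha) (beta_gt0 : 0 < beta)
    (angle_sum : alpha + beta < pi)
    (alpha_alg : trig_algebraic alpha) (beta_alg : trig_algebraic beta)
    (v : 'I_3 -> 'rV[R]_2) (v_tri : noncollinear v)
    (angle0 : interior_angle v 0 = alpha)
    (angle1 : interior_angle v 1 = beta)
    (angle2 : interior_angle v 2 = pi - alpha - beta) :
  forall eps : R, 0 < eps ->
    exists C : R, forall n : nat,
      (complexity v n)%:R < C * expR (n%:R `^ eps).
Proof.
move=> eps eps0; have ar := noncollinear_area v_tri.
have alg := foot_algebraic ar (trig_algebraic_angles alpha_alg beta_alg angle0 angle1 angle2).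
have [K [K0 Kg]] := endpoint_gap alg.
have [C C0 Cb] := bary_le ar; have [c c0 cg] := gap_ge ar.
have [A HA] := card_close_splits C0 c0 Cb cg (run_diff_occ ar) K0 Kg.
have [M LM] := langs_upto_pow HA.
have pl n : (complexity v n <= #|langs (foot (vX v) (vY v)) n|)%N.
  apply/subset_leq_card/fintype.subsetP => w; rewrite !finset.inE => /asboolP h.
  by apply/asboolP; apply: billiard_lang ar _ h.
apply: (quasi_polynomial_bound eps0 _ LM) => [m n mn|].
  apply: leq_trans (pl m) _; have lt : (m < n.+1)%N by [].
  by rewrite /langs_upto (bigD1 (Ordinal lt)) //= leq_addr.
by apply: leq_trans (max_card _) _; rewrite card_tuple expn0.
Qed.
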